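(* Let $k\geq 1$ and let $E^{(k)}$ be the unital Grassmann algebra $E$ over a field $F$ of characteristic zero regarded as an $E$-algebra, where $E$ acts as the subalgebra $E_k$ by left and right multiplication. Then, modulo the $E$-trivial polynomials specified in the context, $\mathrm{Id}^E(E^{(k)})$ is generated, as a $T_E$-ideal, by the polynomials $$[x_1,x_2,x_3],\quad [e_i,x_1,x_2],\quad e_jx,\quad xe_j$$ for all $1\leq i\leq k$ and all $j\geq k+1$. Moreover, $c_n^E(E^{(k)})=2^{n-1}(2^{k+1}-1)$ for all $n\geq 1$.
   Context: All algebras are associative over a field $F$ of characteristic zero. $E$ is the unital algebra generated by $1,e_1,e_2,\ldots$ subject to $e_ie_j=-e_je_i$ for all $i,j$; it has basis $\{e_{i_1}\cdots e_{i_n}\mid i_1<\cdots<i_n,\ n\geq0\}$. $E_k$ is the subalgebra generated by $1,e_1,\ldots,e_k$. Commutators are left-normed: $[a,b]=ab-ba$, $[a,b,c]=[[a,b],c]$. For a unital $F$-algebra $W$, a $W$-algebra is an $F$-algebra $A$ that is a unital $W$-bimodule such that $(a_1a_2)w=a_1(a_2w)$, $w(a_1a_2)=(wa_1)a_2$, $(a_1w)a_2=a_1(wa_2)$. Here $W=E$. The free $W$-algebra $W\langle X\rangle$ on $X=\{x_1,x_2,\ldots\}$ has $F$-basis $\{w_{i_0}x_{j_1}w_{i_1}\cdots x_{j_n}w_{i_n}\mid n\geq 1\}$, where the $w_{i_r}$ run over a fixed basis of $W$ and $j_1,\dots,j_n\ge1$ (expressions are multilinear in the $W$-entries); the product is juxtaposition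 followed by multiplication in $W$, $W$ acts by multiplying the outer entries, and $x_i=1_Wx_i1_W$. A $T_W$-ideal is a two-sided ideal of $W\langle X\rangle$ stable under left and right multiplication by $W$ and under all endomorphisms of $W\langle X\rangle$ as a $W$-algebra. $\mathrm{Id}^W(A)$ is the $T_W$-ideal of all $f\in W\langle X\rangle$ vanishing under all evaluations of the variables in $A$. $P_n^W$ is the space of multilinear elements of $W\langle X\rangle$ in $x_1,\dots,x_n$ and $c_n^W(A)=\dim_FP_n^W/(P_n^W\cap\mathrm{Id}^W(A))$. $E^{(k)}$ is the algebra $E$ with the $E$-action $wa=\theta_k(w)a$, $aw=a\theta_k(w)$, where $\theta_k:E\to E_k$ is the unital homomorphism with $\theta_k(e_i)=e_i$ for $i\leq k$ and $\theta_k(e_j)=0$ for $j\geq k+1$. Convention: the polynomials $[x,g]$, with $g=e_{i_1}\cdots e_{i_{2r}}$ a word of even length, and $[e_i,x,e_j]$, $i,j\geq1$, are regarded as $E$-trivial; ''generated modulo the $E$-trivial polynomials'' means that $\mathrm{Id}^E(E^{(k)})$ is the $T_E$-ideal generated by the displayed polynomials together with these. *)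

(* Defs.v *)
From HB Require Import structures.
From mathcomp Require Import all_boot all_order all_algebra.
From mathcomp Require Import finmap.
From mathcomp Require Import multinomials.monalg.

Set Implicit Arguments.
Unset Strict Implicit.
Unset Printing Implicit Defensive.

Import GRing.Theory.
Local Open Scope fset_scope.
Local Open Scope ring_scope.

Fact basis_key : unit. Proof. by []. Qed.
Fact linext_key : unit. Proof. by []. Qed.

Section LinearExtension.
Context {F : fieldType} {K : choiceType} {V : lmodType F}.
Implicit Types (f : K -> V) (g : {malg F[K]}).

(* [basis] and [linext] are locked: unification would otherwise unfold the
   products defined from them. *)
Definition basis : K -> {malg F[K]} :=
  locked_with basis_key (fun k => mkmalgU k 1).

Lemma basisE k : basis k = << 1 *g k >>.
Proof. by rewrite /basis unlock. Qed.

Definition linext : (K -> V) -> {malg F[K]} -> V :=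
  locked_with linext_key (fun f g => \sum_(k <- msupp g) g@_k *: f k).

Lemma linextE f g : linext f g = \sum_(k <- msupp g) g@_k *: f k.
Proof. by rewrite /linext unlock. Qed.

Lemma linextEw f g (d : {fset K}) : msupp g `<=` d ->
  linext f g = \sum_(k <- d) g@_k *: f k.
Proof.
move=> le; rewrite linextE (big_fset_incl _ le) //= => x _ /mcoeff_outdom ->.
by rewrite scale0r.
Qed.

Lemma linext_linear f : linear (linext f).
Proof.
move=> c g h.
pose d := msupp (c *: g + h) `|` msupp g `|` msupp h.
rewrite !(@linextEw _ _ d); last 3 first.
- by rewrite /d; apply/fsubsetP=> x; rewrite !inE => ->; rewrite !orbT.
- by rewrite /d; apply/fsubsetP=> x; rewrite !inE => ->; rewrite !orbT.
- by rewrite /d; apply/fsubsetP=> x; rewrite !inE => ->.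
rewrite scaler_sumr -big_split /=; apply: eq_bigr => k _.
by rewrite mcoeffD mcoeffZ scalerDl scalerA.
Qed.

HB.instance Definition _ f :=
  GRing.isLinear.Build F {malg F[K]} V *:%R (linext f) (linext_linear f).

Lemma linextU f k : linext f (basis k) = f k.
Proof.
rewrite linextE basisE msuppU oner_eq0 big_seq_fset1 mcoeffUU.
by rewrite scale1r.
Qed.

Lemma malgE_sum g : g = \sum_(k <- msupp g) g@_k *: basis k.
Proof.
rewrite {1}[g]monalgE; apply: eq_bigr => k _.
by apply/malgP => k'; rewrite mcoeffZ basisE !mcoeffU mulrnAr mulr1.
Qed.

Lemma malg_lin_ext (p q : {malg F[K]} -> V) : linear p -> linear q ->
  (forall k, p (basis k) = q (basis k)) -> p =1 q.
Proof.
move=> lp lq pq g.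
pose pM := GRing.isLinear.Build F {malg F[K]} V *:%R p lp.
pose qM := GRing.isLinear.Build F {malg F[K]} V *:%R q lq.
pose P : {linear _ -> _} := HB.pack p pM.
pose Q : {linear _ -> _} := HB.pack q qM.
rewrite (malgE_sum g) -[p _]/(P _) -[q _]/(Q _) !linear_sum.
by apply: eq_bigr => k _; rewrite !linearZ /= pq.
Qed.

Lemma linext_fun_linear (T : lmodType F) (f : K -> T -> V) g :
  (forall k, linear (f k)) -> linear (fun t => linext (f^~ t) g).
Proof.
move=> lf c s t; rewrite !linextE scaler_sumr -big_split /=.
by apply: eq_bigr => k _; rewrite lf scalerDr !scalerA mulrC.
Qed.

Lemma eq_linext f f' g : f =1 f' -> linext f g = linext f' g.
Proof. by move=> ff; rewrite !linextE; apply: eq_bigr => k _; rewrite ff. Qed.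

End LinearExtension.

Lemma linear_linext (F : fieldType) (K : choiceType) (V U : lmodType F)
    (p : V -> U) (f : K -> V) (g : {malg F[K]}) : linear p ->
  p (linext f g) = linext (fun k => p (f k)) g.
Proof.
move=> lp.
pose pM := GRing.isLinear.Build F V U *:%R p lp.
pose P : {linear _ -> _} := HB.pack p pM.
rewrite !linextE -[p _]/(P _) linear_sum; apply: eq_bigr => k _.
by rewrite linearZ.
Qed.

Lemma linext_exchange (F : fieldType) (K L : choiceType) (V : lmodType F)
    (f : K -> L -> V) (g : {malg F[K]}) (h : {malg F[L]}) :
  linext (fun k => linext (f k) h) g = linext (fun l => linext (f^~ l) g) h.
Proof.
rewrite !linextE; under eq_bigr do rewrite linextE scaler_sumr.
rewrite exchange_big /=; apply: eq_bigr => l _.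
by rewrite linextE scaler_sumr; apply: eq_bigr => k _; rewrite !scalerA mulrC.
Qed.

Section BilinearExtension.
Context {F : fieldType} {K L : choiceType} {V : lmodType F}.
Implicit Types (m : K -> L -> V).

Definition bilext m (x : {malg F[K]}) (y : {malg F[L]}) : V :=
  linext (fun a => linext (m a) y) x.

Lemma bilext_linear_l m y : linear (bilext m ^~ y).
Proof. exact: linext_linear. Qed.

Lemma bilext_linear_r m x : linear (bilext m x).
Proof. by apply: linext_fun_linear => k; apply: linext_linear. Qed.

Lemma bilextUU m a b : bilext m (basis a) (basis b) = m a b.
Proof. by rewrite /bilext !linextU. Qed.

End BilinearExtension.

Section PlainLinear.
Context {F : fieldType} {U V W : lmodType F}.

Lemma linear_comp (p : V -> W) (q : U -> V) :
  linear p -> linear q -> linear (fun x => p (q x)).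
Proof. by move=> lp lq c x y; rewrite lq lp. Qed.

Lemma lin0 (p : U -> V) : linear p -> p 0 = 0.
Proof. by move=> /(_ (-1) 0 0); rewrite !scaleN1r !(oppr0, addr0) addNr. Qed.

Lemma linZ (p : U -> V) : linear p -> forall c x, p (c *: x) = c *: p x.
Proof. by move=> lp c x; rewrite -[c *: x]addr0 lp (lin0 lp) addr0. Qed.

End PlainLinear.

(* The Grassmann algebra.  Generators are numbered from 0: [gen i] is the
   mathematicians' e_(i+1).  The basis element e_{i_1}...e_{i_n} with
   i_1 < ... < i_n is indexed by the finite set {i_1, ..., i_n}. *)

(* The number of transpositions needed to sort e_A e_B. *)
Definition inversions (A B : {fset nat}) : nat :=
  (\sum_(a <- A) \sum_(b <- B) (b < a))%N.

Definition grassmann (F : fieldType) := {malg F[{fset nat}]}.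

HB.instance Definition _ (F : fieldType) := GRing.Lmodule.on (grassmann F).

Section Grassmann.
Context {F : fieldType}.
Local Notation E := (grassmann F).

Definition gbase (A : {fset nat}) : E := basis A.

Definition gmul_base (A B : {fset nat}) : E :=
  if [disjoint A & B]%fset then (-1) ^+ inversions A B *: gbase (A `|` B) else 0.

Definition gmul : E -> E -> E := bilext gmul_base.

Lemma sum_fsetU A B (f : nat -> nat) : [disjoint A & B]%fset ->
  (\sum_(i <- A `|` B) f i = \sum_(i <- A) f i + \sum_(i <- B) f i)%N.
Proof.
move=> dAB; rewrite -big_cat; apply: perm_big; apply: uniq_perm => //.
  rewrite cat_uniq !fset_uniq andbT /=; apply/hasPn => b bB.
  by apply: contraL bB => bA; apply: (fdisjointP dAB).
by move=> i; rewrite mem_cat inE.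
Qed.

Lemma inversionsUl A B C : [disjoint A & B]%fset ->
  inversions (A `|` B) C = (inversions A C + inversions B C)%N.
Proof. exact: sum_fsetU. Qed.

Lemma inversionsUr A B C : [disjoint B & C]%fset ->
  inversions A (B `|` C) = (inversions A B + inversions A C)%N.
Proof.
move=> dBC; rewrite /inversions -big_split /=; apply: eq_bigr => a _.
exact: sum_fsetU.
Qed.

Lemma gmul_linear_l y : linear (gmul^~ y).
Proof. exact: bilext_linear_l. Qed.

Lemma gmul_linear_r x : linear (gmul x).
Proof. exact: bilext_linear_r. Qed.

Lemma gmul_baseE A B : gmul (gbase A) (gbase B) = gmul_base A B.
Proof. exact: bilextUU. Qed.

Lemma gmul_baseA A B C :
  gmul (gbase A) (gmul_base B C) = gmul (gmul_base A B) (gbase C).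
Proof.
have gl0 y : gmul 0 y = 0 by exact: lin0 (gmul_linear_l y).
have gr0 x : gmul x 0 = 0 by exact: lin0 (gmul_linear_r x).
have glZ c x y : gmul (c *: x) y = c *: gmul x y.
  exact: (linZ (gmul_linear_l y)).
have grZ c x y : gmul x (c *: y) = c *: gmul x y.
  exact: (linZ (gmul_linear_r x)).
have bT A' B' : [disjoint A' & B']%fset ->
  gmul_base A' B' = (-1) ^+ inversions A' B' *: gbase (A' `|` B').
  by rewrite /gmul_base => ->.
have bF A' B' : ~~ [disjoint A' & B']%fset -> gmul_base A' B' = 0.
  by rewrite /gmul_base => /negbTE ->.
have [dBC|nBC] := boolP [disjoint B & C]%fset;
  have [dAB|nAB] := boolP [disjoint A & B]%fset.
- rewrite (bT _ _ dBC) (bT _ _ dAB) grZ glZ !gmul_baseE.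
  have [dAC|nAC] := boolP [disjoint A & C]%fset; last first.
    by rewrite !bF ?scaler0 // ?fdisjointXU ?fdisjointUX (negbTE nAC) ?andbF.
  have dl : [disjoint A & B `|` C]%fset by rewrite fdisjointXU dAB dAC.
  have dr : [disjoint A `|` B & C]%fset by rewrite fdisjointUX dAC dBC.
  rewrite (bT _ _ dl) (bT _ _ dr) !scalerA -!exprD.
  rewrite (inversionsUl _ dAB) (inversionsUr _ dBC) fsetUA.
  have -> // : (inversions B C + (inversions A B + inversions A C) =
    inversions A B + (inversions A C + inversions B C))%N.
  by rewrite addnC addnA.
- rewrite (bT _ _ dBC) (bF _ _ nAB) gl0 grZ gmul_baseE bF ?scaler0 //.
  by rewrite fdisjointXU (negbTE nAB).
- rewrite (bF _ _ nBC) (bT _ _ dAB) gr0 glZ gmul_baseE bF ?scaler0 //.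
  by rewrite fdisjointUX (negbTE nBC) andbF.
- by rewrite (bF _ _ nBC) (bF _ _ nAB) gl0 gr0.
Qed.

Lemma gmulA : associative gmul.
Proof.
move=> x y z; move: x.
apply: malg_lin_ext; first exact: gmul_linear_l.
  exact: linear_comp (gmul_linear_l z) (gmul_linear_l y).
move=> A; move: y; apply: malg_lin_ext.
- exact: linear_comp (gmul_linear_r _) (gmul_linear_l z).
- exact: linear_comp (gmul_linear_l z) (gmul_linear_r _).
move=> B; move: z; apply: malg_lin_ext.
- exact: linear_comp (gmul_linear_r _) (gmul_linear_r _).
- exact: gmul_linear_r.
by move=> C; rewrite -/(gbase A) -/(gbase B) -/(gbase C) !gmul_baseE gmul_baseA.
Qed.

Lemma inversions0s A : inversions fset0 A = 0%N.
Proof. by rewrite /inversions big_seq_fset0. Qed.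

Lemma inversionss0 A : inversions A fset0 = 0%N.
Proof. by rewrite /inversions big1 // => a _; rewrite big_seq_fset0. Qed.

Lemma gmul1g : left_id (gbase fset0) gmul.
Proof.
apply: malg_lin_ext => [|c x y //|A]; first exact: gmul_linear_r.
rewrite -/(gbase A) gmul_baseE /gmul_base fdisjoint0X inversions0s scale1r.
by rewrite fset0U.
Qed.

Lemma gmulg1 : right_id (gbase fset0) gmul.
Proof.
apply: malg_lin_ext => [|c x y //|A]; first exact: gmul_linear_l.
rewrite -/(gbase A) gmul_baseE /gmul_base fdisjointX0 inversionss0 scale1r.
by rewrite fsetU0.
Qed.

Lemma gmulDl : left_distributive gmul +%R.
Proof. by move=> x y z; have := gmul_linear_l z 1 x y; rewrite !scale1r. Qed.

Lemma gmulDr : right_distributive gmul +%R.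
Proof. by move=> z x y; have := gmul_linear_r z 1 x y; rewrite !scale1r. Qed.

Lemma gone_neq0 : gbase fset0 != 0.
Proof. by rewrite /gbase basisE monalgU_eq0 oner_neq0. Qed.

HB.instance Definition _ := GRing.Zmodule_isNzRing.Build E
  gmulA gmul1g gmulg1 gmulDl gmulDr gone_neq0.

Lemma gscaleAl (c : F) (x y : E) : c *: (x * y) = (c *: x) * y.
Proof. by rewrite [RHS](linZ (gmul_linear_l y)). Qed.

HB.instance Definition _ := GRing.Lmodule_isLalgebra.Build F E gscaleAl.

Lemma gscaleAr (c : F) (x y : E) : c *: (x * y) = x * (c *: y).
Proof. by rewrite [RHS](linZ (gmul_linear_r x)). Qed.

HB.instance Definition _ := GRing.Lalgebra_isAlgebra.Build F E gscaleAr.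

Lemma gbase0 : gbase fset0 = 1.
Proof. by []. Qed.

Definition gen (i : nat) : E := gbase [fset i].

Lemma gmulE A B : gbase A * gbase B =
  if [disjoint A & B]%fset then (-1) ^+ inversions A B *: gbase (A `|` B)
  else 0.
Proof. exact: gmul_baseE. Qed.

Lemma gen_anticomm i j : gen i * gen j = - (gen j * gen i).
Proof.
rewrite !gmulE fdisjoint1X inE fdisjoint1X inE eq_sym.
case: eqP => [->|/eqP ne] /=; first by rewrite oppr0.
rewrite (fsetUC [fset i]) -scaleNr.
apply: (f_equal (fun c : F => c *: _)).
rewrite /inversions !big_seq_fset1.
have -> : (j < i)%N = ~~ (i < j)%N
  by rewrite -leqNgt [RHS]leq_eqVlt (negbTE ne).
by case: (i < j)%N; rewrite expr0 expr1 ?opprK.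
Qed.

Lemma gen_prod (s : seq nat) : sorted ltn s ->
  \prod_(i <- s) gen i = gbase [fset i in s].
Proof.
elim: s => [|i s IHs] srt.
  by rewrite big_nil; congr gbase; apply/fsetP => j; rewrite !inE.
rewrite big_cons IHs ?(path_sorted srt) // gmulE.
have lt_i : {in s, forall j, i < j}%N.
  by apply/allP; apply: order_path_min srt; exact: ltn_trans.
have -> : [disjoint [fset i] & [fset j in s]]%fset.
  by rewrite fdisjoint1X !inE; apply/negP => /lt_i; rewrite ltnn.
have -> : [fset j in i :: s] = i |` [fset j in s].
  by apply/fsetP => j; rewrite !inE.
suff -> : inversions [fset i] [fset j in s] = 0%N.
  by rewrite scale1r.
rewrite /inversions big_seq_fset1 big_seq big1 // => j.
by rewrite !inE => /lt_i ltij; rewrite ltnNge ltnW.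
Qed.


Definition theta (k : nat) : E -> E :=
  linext (fun A => if A `<=` [fset i in iota 0 k] then gbase A else 0).

HB.instance Definition _ k := GRing.Linear.on (theta k).

Lemma theta_base k A :
  theta k (gbase A) = if A `<=` [fset i in iota 0 k] then gbase A else 0.
Proof. exact: linextU. Qed.

Lemma theta_linear k : linear (theta k).
Proof. exact: linext_linear. Qed.

Lemma theta1 k : theta k 1 = 1.
Proof. by rewrite -[1]/(gbase fset0) theta_base fsub0set. Qed.

Lemma thetaM k : {morph theta k : x y / x * y}.
Proof.
move=> x y; move: x; apply: malg_lin_ext.
- exact: linear_comp (theta_linear k) (gmul_linear_l y).
- exact: linear_comp (gmul_linear_l _) (theta_linear k).
move=> A; move: y; apply: malg_lin_ext.
- exact: linear_comp (theta_linear k) (gmul_linear_r _).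
- exact: linear_comp (gmul_linear_r _) (theta_linear k).
move=> B; rewrite -/(gbase A) -/(gbase B) gmulE !theta_base.
have [dAB|nAB] := boolP [disjoint A & B]%fset.
  rewrite (linZ (theta_linear k)) theta_base fsubUset.
  have [_|_] := boolP (A `<=` _); have [_|_] := boolP (B `<=` _) => /=.
  - by rewrite gmulE dAB.
  - by rewrite mulr0 scaler0.
  - by rewrite mul0r scaler0.
  - by rewrite mul0r scaler0.
rewrite linear0; have [_|_] := boolP (A `<=` _); last by rewrite mul0r.
by have [_|_] := boolP (B `<=` _); rewrite ?mulr0 // gmulE (negbTE nAB).
Qed.

HB.instance Definition _ k :=
  GRing.isMonoidMorphism.Build E E (theta k) (conj (theta1 k) (thetaM k)).

Lemma theta_gen k i : theta k (gen i) = if (i < k)%N then gen i else 0.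
Proof.
by rewrite theta_base fsub1set !inE mem_iota add0n.
Qed.

End Grassmann.

(* An algebra over F, not necessarily unital, with a compatible unital
   W-bimodule structure. *)
Record wAlgebra (F : fieldType) (W : algType F) := WAlgebra {
  wcar :> lmodType F;
  wmul : wcar -> wcar -> wcar;
  lact : W -> wcar -> wcar;
  ract : wcar -> W -> wcar;
  wmul_linear_l : forall b, linear (wmul^~ b);
  wmul_linear_r : forall a, linear (wmul a);
  lact_linear_l : forall a, linear (lact^~ a);
  lact_linear_r : forall w, linear (lact w);
  ract_linear_l : forall w, linear (ract^~ w);
  ract_linear_r : forall a, linear (ract a);
  wmulA : forall a b c, wmul a (wmul b c) = wmul (wmul a b) c;
  lact1 : forall a, lact 1 a = a;
  ract1 : forall a, ract a 1 = a;
  lactM : forall w w' a, lact (w * w') a = lact w (lact w' a);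
  ractM : forall a w w', ract a (w * w') = ract (ract a w) w';
  lact_ract : forall w a w', ract (lact w a) w' = lact w (ract a w');
  wmul_ract : forall a b w, ract (wmul a b) w = wmul a (ract b w);
  lact_wmul : forall w a b, lact w (wmul a b) = wmul (lact w a) b;
  ract_wmul : forall a w b, wmul (ract a w) b = wmul a (lact w b)
}.

Arguments wmul {F W _}.
Arguments lact {F W _}.
Arguments ract {F W _}.

Section WAlgebraTheory.
Context {F : fieldType} {W : algType F}.

Definition wcomm {A : wAlgebra W} (a b : A) : A := wmul a b - wmul b a.
Definition lcomm {A : wAlgebra W} (w : W) (a : A) : A := lact w a - ract a w.
Definition rcomm {A : wAlgebra W} (a : A) (w : W) : A := ract a w - lact w a.

Record whom (A B : wAlgebra W) (phi : A -> B) : Prop := WHom {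
  whom_linear : linear phi;
  whom_mul : forall a b, phi (wmul a b) = wmul (phi a) (phi b);
  whom_lact : forall w a, phi (lact w a) = lact w (phi a);
  whom_ract : forall a w, phi (ract a w) = ract (phi a) w
}.

(* T_W-ideals; meant for A the free W-algebra. *)
Record TW_ideal (A : wAlgebra W) (I : A -> Prop) : Prop := TWIdeal {
  TW0 : I 0;
  TWD : forall c f g, I f -> I g -> I (c *: f + g);
  TWmull : forall f g, I g -> I (wmul f g);
  TWmulr : forall f g, I f -> I (wmul f g);
  TWlact : forall w f, I f -> I (lact w f);
  TWract : forall f w, I f -> I (ract f w);
  TWend : forall phi : A -> A, whom phi -> forall f, I f -> I (phi f)
}.

Definition TW_span (A : wAlgebra W) (S : A -> Prop) (f : A) : Prop :=
  forall I : A -> Prop, TW_ideal I -> (forall g, S g -> I g) -> I f.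

End WAlgebraTheory.

(* [grassmannK k] is E^(k). *)
Section GrassmannK.
Context {F : fieldType} (k : nat).
Local Notation E := (grassmann F).

Definition grassmannK_lact (w a : E) : E := theta k w * a.
Definition grassmannK_ract (a w : E) : E := a * theta k w.

Lemma grassmannK_lact_ll a : linear (grassmannK_lact^~ a).
Proof. exact: linear_comp (gmul_linear_l a) (theta_linear k). Qed.
Lemma grassmannK_lact_lr w : linear (grassmannK_lact w).
Proof. exact: gmul_linear_r. Qed.
Lemma grassmannK_ract_ll w : linear (grassmannK_ract^~ w).
Proof. exact: gmul_linear_l. Qed.
Lemma grassmannK_ract_lr a : linear (grassmannK_ract a).
Proof. exact: linear_comp (gmul_linear_r a) (theta_linear k). Qed.
Lemma grassmannK_lact1 a : grassmannK_lact 1 a = a.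
Proof. by rewrite /grassmannK_lact theta1 mul1r. Qed.
Lemma grassmannK_ract1 a : grassmannK_ract a 1 = a.
Proof. by rewrite /grassmannK_ract theta1 mulr1. Qed.
Lemma grassmannK_lactM w w' a :
  grassmannK_lact (w * w') a = grassmannK_lact w (grassmannK_lact w' a).
Proof. by rewrite /grassmannK_lact thetaM mulrA. Qed.
Lemma grassmannK_ractM a w w' :
  grassmannK_ract a (w * w') = grassmannK_ract (grassmannK_ract a w) w'.
Proof. by rewrite /grassmannK_ract thetaM mulrA. Qed.
Lemma grassmannK_lact_ract w a w' :
  grassmannK_ract (grassmannK_lact w a) w' =
  grassmannK_lact w (grassmannK_ract a w').
Proof. by rewrite /grassmannK_lact /grassmannK_ract mulrA. Qed.
Lemma grassmannK_mul_ract (a b w : E) :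
  grassmannK_ract (a * b) w = a * grassmannK_ract b w.
Proof. by rewrite /grassmannK_ract mulrA. Qed.
Lemma grassmannK_lact_mul (w a b : E) :
  grassmannK_lact w (a * b) = grassmannK_lact w a * b.
Proof. by rewrite /grassmannK_lact mulrA. Qed.
Lemma grassmannK_ract_mul (a w b : E) :
  grassmannK_ract a w * b = a * grassmannK_lact w b.
Proof. by rewrite /grassmannK_lact /grassmannK_ract mulrA. Qed.

Definition grassmannK : wAlgebra E :=
  @WAlgebra F E E *%R grassmannK_lact grassmannK_ract
    gmul_linear_l gmul_linear_r grassmannK_lact_ll grassmannK_lact_lr
    grassmannK_ract_ll grassmannK_ract_lr (@mulrA E) grassmannK_lact1
    grassmannK_ract1 grassmannK_lactM grassmannK_ractM grassmannK_lact_ract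
    grassmannK_mul_ract grassmannK_lact_mul grassmannK_ract_mul.

End GrassmannK.

(* The basis of E<X>: the word w_0 x_{j_1} w_1 ... x_{j_n} w_n, n >= 1, is
   encoded as ((w_0, j_1), [:: (w_1, j_2); ...; (w_(n-1), j_n)], w_n), each w_r
   being given by the index of a basis element of E.  Variables are numbered
   from 0. *)
Definition word : Type :=
  ({fset nat} * nat) * seq ({fset nat} * nat) * {fset nat}.

Definition word_vars (u : word) : seq nat := u.1.1.2 :: map snd u.1.2.

Section FreeAlgebra.
Context {F : fieldType}.
Local Notation E := (grassmann F).
Local Notation FX := {malg F[word]}.

Definition word_mul (u v : word) : FX :=
  let: ((h, s), w) := u in let: ((w', j), s', w'') := v in
  linext (fun C => basis ((h, s ++ (C, j) :: s'), w'') : FX)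
         (gbase w * gbase w' : E).

Definition word_lact (w : E) (u : word) : FX :=
  let: ((w', j), s, w'') := u in
  linext (fun C => basis (((C, j), s), w'') : FX) (w * gbase w' : E).

Definition word_ract (u : word) (w : E) : FX :=
  let: (h, s, w') := u in
  linext (fun C => basis ((h, s), C) : FX) (gbase w' * w : E).

Lemma word_mulE h s w w' j s' w'' :
  word_mul ((h, s), w) (((w', j), s'), w'') =
  linext (fun C => basis ((h, s ++ (C, j) :: s'), w'') : FX)
         (gbase w * gbase w' : E).
Proof. by []. Qed.
Lemma word_lactE w w' j s w'' : word_lact w (((w', j), s), w'') =
  linext (fun C => basis (((C, j), s), w'') : FX) (w * gbase w' : E).
Proof. by []. Qed.
Lemma word_ractE h s w' w : word_ract ((h, s), w') w =
  linext (fun C => basis ((h, s), C) : FX) (gbase w' * w : E).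
Proof. by []. Qed.

Definition free_mul : FX -> FX -> FX := bilext word_mul.
Definition free_lact (w : E) (f : FX) : FX := linext (word_lact w) f.
Definition free_ract (f : FX) (w : E) : FX := linext (word_ract^~ w) f.

Lemma free_mul_ll g : linear (free_mul^~ g).
Proof. exact: bilext_linear_l. Qed.
Lemma free_mul_lr f : linear (free_mul f).
Proof. exact: bilext_linear_r. Qed.
Lemma free_lact_lr w : linear (free_lact w).
Proof. exact: linext_linear. Qed.
Lemma free_ract_ll w : linear (free_ract^~ w).
Proof. exact: linext_linear. Qed.

Lemma word_lact_linear u : linear (word_lact^~ u).
Proof.
case: u => [[[w j] s] w'']; apply: linear_comp (linext_linear _) _.
exact: gmul_linear_l.
Qed.

Lemma word_ract_linear u : linear (word_ract u).
Proof.
case: u => [[h s] w]; apply: linear_comp (linext_linear _) _.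
exact: gmul_linear_r.
Qed.

Lemma free_lact_ll f : linear (free_lact^~ f).
Proof.
exact: (linext_fun_linear (f := fun u w => word_lact w u) _ word_lact_linear).
Qed.

Lemma free_ract_lr f : linear (free_ract f).
Proof.
exact: (linext_fun_linear (f := fun u w => word_ract u w) _ word_ract_linear).
Qed.

Lemma free_mulUU u v : free_mul (basis u) (basis v) = word_mul u v.
Proof. exact: bilextUU. Qed.
Lemma free_lactU w u : free_lact w (basis u) = word_lact w u.
Proof. exact: linextU. Qed.
Lemma free_ractU w u : free_ract (basis u) w = word_ract u w.
Proof. exact: linextU. Qed.

Section Linext.
Context {K : choiceType} (p : K -> FX) (y : {malg F[K]}).
Lemma free_mul_linextl g :
  free_mul (linext p y) g = linext (fun k => free_mul (p k) g) y.
Proof. exact: (linear_linext p y (free_mul_ll g)). Qed.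
Lemma free_mul_linextr f :
  free_mul f (linext p y) = linext (fun k => free_mul f (p k)) y.
Proof. exact: (linear_linext p y (free_mul_lr f)). Qed.
Lemma free_lact_linext w :
  free_lact w (linext p y) = linext (fun k => free_lact w (p k)) y.
Proof. exact: (linear_linext p y (free_lact_lr w)). Qed.
Lemma free_ract_linext w :
  free_ract (linext p y) w = linext (fun k => free_ract (p k) w) y.
Proof. exact: (linear_linext p y (free_ract_ll w)). Qed.
End Linext.

Lemma linext_mull (V : lmodType F) (f : {fset nat} -> V) (x y : E) :
  linext f (x * y) = linext (fun C => linext f (x * gbase C)) y.
Proof.
move: y; apply: malg_lin_ext.
- exact: linear_comp (linext_linear f) (gmul_linear_r x).
- exact: linext_linear.
by move=> C; rewrite linextU.
Qed.

Lemma linext_mulr (V : lmodType F) (f : {fset nat} -> V) (x y : E) :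
  linext f (x * y) = linext (fun C => linext f (gbase C * y)) x.
Proof.
move: x; apply: malg_lin_ext.
- exact: linear_comp (linext_linear f) (gmul_linear_l y).
- exact: linext_linear.
by move=> C; rewrite linextU.
Qed.

Lemma free_mulA f g h : free_mul f (free_mul g h) = free_mul (free_mul f g) h.
Proof.
move: f; apply: malg_lin_ext.
- exact: free_mul_ll.
- exact: linear_comp (free_mul_ll h) (free_mul_ll g).
move=> u; move: g; apply: malg_lin_ext.
- exact: linear_comp (free_mul_lr _) (free_mul_ll h).
- exact: linear_comp (free_mul_ll h) (free_mul_lr _).
move=> v; move: h; apply: malg_lin_ext.
- exact: linear_comp (free_mul_lr _) (free_mul_lr _).
- exact: free_mul_lr.
move=> t; rewrite !free_mulUU.
case: u v t => [[h s] w] [[[v0 j] s'] v1] [[[t0 j'] s''] t1].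
rewrite !word_mulE free_mul_linextr free_mul_linextl.
transitivity (linext (fun C => linext (fun D =>
  basis (h, s ++ (D, j) :: s' ++ (C, j') :: s'', t1) : FX) (gbase w * gbase v0))
    (gbase v1 * gbase t0)).
  by apply: eq_linext => C; rewrite free_mulUU.
rewrite linext_exchange; apply: eq_linext => C.
by rewrite free_mulUU word_mulE; apply: eq_linext => D; rewrite -catA.
Qed.

Lemma free_lact1 f : free_lact 1 f = f.
Proof.
move: f; apply: malg_lin_ext => [|c x y //|]; first exact: free_lact_lr.
by move=> [[[w j] s] w']; rewrite free_lactU word_lactE mul1r linextU.
Qed.

Lemma free_ract1 f : free_ract f 1 = f.
Proof.
move: f; apply: malg_lin_ext => [|c x y //|]; first exact: free_ract_ll.
by move=> [[h s] w']; rewrite free_ractU word_ractE mulr1 linextU.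
Qed.

Lemma free_lactM w w' f : free_lact (w * w') f = free_lact w (free_lact w' f).
Proof.
move: f; apply: malg_lin_ext.
- exact: free_lact_lr.
- exact: linear_comp (free_lact_lr _) (free_lact_lr _).
move=> [[[w0 j] s] w1]; rewrite !free_lactU !word_lactE -mulrA linext_mull.
rewrite free_lact_linext.
by apply: eq_linext => C; rewrite free_lactU.
Qed.

Lemma free_ractM f w w' : free_ract f (w * w') = free_ract (free_ract f w) w'.
Proof.
move: f; apply: malg_lin_ext.
- exact: free_ract_ll.
- exact: linear_comp (free_ract_ll _) (free_ract_ll _).
move=> [[h s] w1]; rewrite !free_ractU !word_ractE mulrA linext_mulr.
rewrite free_ract_linext.
by apply: eq_linext => C; rewrite free_ractU.
Qed.

Lemma free_lact_ract w f w' :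
  free_ract (free_lact w f) w' = free_lact w (free_ract f w').
Proof.
move: f; apply: malg_lin_ext.
- exact: linear_comp (free_ract_ll _) (free_lact_lr _).
- exact: linear_comp (free_lact_lr _) (free_ract_ll _).
move=> [[[w0 j] s] w1]; rewrite free_lactU free_ractU word_lactE word_ractE.
rewrite free_lact_linext.
rewrite free_ract_linext.
transitivity (linext (fun C => linext (fun D => basis (C, j, s, D) : FX)
   (gbase w1 * w')) (w * gbase w0)).
  by apply: eq_linext => C; rewrite free_ractU.
by rewrite linext_exchange; apply: eq_linext => C; rewrite free_lactU.
Qed.

Lemma free_mul_ract f g w :
  free_ract (free_mul f g) w = free_mul f (free_ract g w).
Proof.
move: f; apply: malg_lin_ext.
- exact: linear_comp (free_ract_ll _) (free_mul_ll _).
- exact: free_mul_ll.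
move=> u; move: g; apply: malg_lin_ext.
- exact: linear_comp (free_ract_ll _) (free_mul_lr _).
- exact: linear_comp (free_mul_lr _) (free_ract_ll _).
move=> v; rewrite free_mulUU free_ractU.
case: u v => [[h s] w0] [[[v0 j] s'] v1].
rewrite ?word_mulE ?word_lactE ?word_ractE.
rewrite free_mul_linextr.
rewrite free_ract_linext.
transitivity (linext (fun C => linext (fun D =>
  basis (h, s ++ (C, j) :: s', D) : FX)
   (gbase v1 * w)) (gbase w0 * gbase v0)).
  by apply: eq_linext => C; rewrite free_ractU.
by rewrite linext_exchange; apply: eq_linext => C; rewrite free_mulUU.
Qed.

Lemma free_lact_mul w f g :
  free_lact w (free_mul f g) = free_mul (free_lact w f) g.
Proof.
move: f; apply: malg_lin_ext.
- exact: linear_comp (free_lact_lr _) (free_mul_ll _).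
- exact: linear_comp (free_mul_ll _) (free_lact_lr _).
move=> u; move: g; apply: malg_lin_ext.
- exact: linear_comp (free_lact_lr _) (free_mul_lr _).
- exact: free_mul_lr.
move=> v; rewrite free_mulUU free_lactU.
case: u v => [[[u0 i] s] u1] [[[v0 j] s'] v1].
rewrite ?word_mulE ?word_lactE ?word_ractE.
rewrite free_mul_linextl.
rewrite free_lact_linext.
transitivity (linext (fun C => linext (fun D =>
  basis (D, i, s ++ (C, j) :: s', v1) : FX)
   (w * gbase u0)) (gbase u1 * gbase v0)).
  by apply: eq_linext => C; rewrite free_lactU.
by rewrite linext_exchange; apply: eq_linext => C; rewrite free_mulUU.
Qed.

Lemma free_ract_mul f w g :
  free_mul (free_ract f w) g = free_mul f (free_lact w g).
Proof.
move: f; apply: malg_lin_ext.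
- exact: linear_comp (free_mul_ll _) (free_ract_ll _).
- exact: free_mul_ll.
move=> u; move: g; apply: malg_lin_ext.
- exact: free_mul_lr.
- exact: linear_comp (free_mul_lr _) (free_lact_lr _).
move=> v; rewrite free_ractU free_lactU.
case: u v => [[h s] u1] [[[v0 j] s'] v1].
rewrite ?word_mulE ?word_lactE ?word_ractE.
rewrite free_mul_linextl.
rewrite free_mul_linextr.
set f := fun C => basis (h, s ++ (C, j) :: s', v1) : FX.
transitivity (linext f (gbase u1 * w * gbase v0)).
  by rewrite [RHS]linext_mulr; apply: eq_linext => C; rewrite free_mulUU.
by rewrite -mulrA [LHS]linext_mull; apply: eq_linext => C; rewrite free_mulUU.
Qed.

End FreeAlgebra.

Definition freeEX (F : fieldType) : wAlgebra (grassmann F) :=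
  @WAlgebra F (grassmann F) {malg F[word]} free_mul free_lact free_ract
    free_mul_ll free_mul_lr free_lact_ll free_lact_lr free_ract_ll free_ract_lr
    free_mulA free_lact1 free_ract1 free_lactM free_ractM free_lact_ract
    free_mul_ract free_lact_mul free_ract_mul.

Definition var {F : fieldType} (i : nat) : freeEX F :=
  basis ((fset0, i), [::], fset0) : {malg F[word]}.

Section Evaluation.
Context {F : fieldType} {A : wAlgebra (grassmann F)}.
Implicit Type a : nat -> A.

Definition word_step a (p : A) (wj : {fset nat} * nat) : A :=
  wmul p (lact (gbase wj.1) (a wj.2)).

Definition word_eval a (u : word) : A :=
  let: ((w0, j), s, wn) := u in
  ract (foldl (word_step a) (lact (gbase w0) (a j)) s) (gbase wn).

Definition eval a (f : freeEX F) : A := linext (word_eval a) f.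

Lemma word_evalE a w0 j s wn : word_eval a ((w0, j), s, wn) =
  ract (foldl (word_step a) (lact (gbase w0) (a j)) s) (gbase wn).
Proof. by []. Qed.

Lemma eval_linear a : linear (eval a).
Proof. exact: linext_linear. Qed.

Lemma eval_basis a u : eval a (basis u) = word_eval a u.
Proof. exact: linextU. Qed.

Lemma eval_linext a (K : choiceType) (p : K -> {malg F[word]}) y :
  eval a (linext p y) = linext (fun k => eval a (p k)) y.
Proof. exact: (linear_linext p y (eval_linear a)). Qed.

Lemma foldl_linear a s : linear (fun x : A => foldl (word_step a) x s).
Proof.
elim: s => [|wj s IHs] //= c x y; rewrite -IHs; congr foldl.
exact: wmul_linear_l.
Qed.

Lemma foldl_wmul a x y s :
  foldl (word_step a) (wmul x y) s = wmul x (foldl (word_step a) y s).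
Proof.
elim: s y => [|wj s IHs] y //=.
by rewrite {2}/word_step -wmulA IHs.
Qed.

Lemma foldl_lact a w x s :
  foldl (word_step a) (lact w x) s = lact w (foldl (word_step a) x s).
Proof.
elim: s x => [|wj s IHs] x //=.
by rewrite {2}/word_step -lact_wmul IHs.
Qed.

Lemma linext_id (p : grassmann F -> A) : linear p ->
  forall x, linext (fun C => p (gbase C)) x = p x.
Proof.
move=> lp; apply: malg_lin_ext => //; first exact: linext_linear.
by move=> C; rewrite linextU.
Qed.

Lemma eval_mul a f g : eval a (wmul f g) = wmul (eval a f) (eval a g).
Proof.
move: f; apply: malg_lin_ext.
- exact: linear_comp (eval_linear a) (wmul_linear_l g).
- exact: linear_comp (wmul_linear_l _) (eval_linear a).
move=> u; move: g; apply: malg_lin_ext.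
- exact: linear_comp (eval_linear a) (wmul_linear_r _).
- exact: linear_comp (wmul_linear_r _) (eval_linear a).
move=> v.
have -> : @wmul _ _ (freeEX F) (basis u) (basis v) = word_mul u v.
  exact: free_mulUU.
rewrite !eval_basis.
case: u v => [[[u0 i] s] u1] [[[v0 j] s'] v1].
rewrite word_mulE eval_linext !word_evalE.
set pre := foldl _ _ s.
pose L (x : grassmann F) : A :=
  wmul pre (ract (foldl (word_step a) (lact x (a j)) s') (gbase v1)).
have lL : linear L.
  apply: linear_comp (wmul_linear_r _) _.
  apply: linear_comp (ract_linear_l _) _.
  exact: linear_comp (foldl_linear a s') (lact_linear_l _).
transitivity (linext (fun C => L (gbase C)) (gbase u1 * gbase v0)).
  apply: eq_linext => C; rewrite eval_basis word_evalE foldl_cat -/pre.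
  by rewrite /L -wmul_ract -foldl_wmul.
by rewrite linext_id // /L ract_wmul lactM foldl_lact lact_ract.
Qed.

Lemma eval_lact a w f : eval a (lact w f) = lact w (eval a f).
Proof.
move: f; apply: malg_lin_ext.
- exact: linear_comp (eval_linear a) (lact_linear_r _).
- exact: linear_comp (lact_linear_r _) (eval_linear a).
move=> u.
have -> : @lact _ _ (freeEX F) w (basis u) = word_lact w u.
  exact: free_lactU.
rewrite eval_basis; case: u => [[[w0 j] s] w1].
rewrite word_lactE eval_linext word_evalE.
pose L (x : grassmann F) : A :=
  ract (foldl (word_step a) (lact x (a j)) s) (gbase w1).
have lL : linear L.
  apply: linear_comp (ract_linear_l _) _.
  exact: linear_comp (foldl_linear a s) (lact_linear_l _).
transitivity (linext (fun C => L (gbase C)) (w * gbase w0)).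
  by apply: eq_linext => C; rewrite eval_basis.
by rewrite linext_id // /L lactM foldl_lact lact_ract.
Qed.

Lemma eval_ract a f w : eval a (ract f w) = ract (eval a f) w.
Proof.
move: f; apply: malg_lin_ext.
- exact: linear_comp (eval_linear a) (ract_linear_l _).
- exact: linear_comp (ract_linear_l _) (eval_linear a).
move=> u.
have -> : @ract _ _ (freeEX F) (basis u) w = word_ract u w.
  exact: free_ractU.
rewrite eval_basis; case: u => [[[w0 j] s] w1].
rewrite word_ractE eval_linext word_evalE -ractM.
rewrite -[RHS](linext_id (ract_linear_r _)).
by apply: eq_linext => C; rewrite eval_basis.
Qed.

Lemma eval_whom a : whom (eval a).
Proof.
split; [exact: eval_linear | exact: eval_mul | exact: eval_lact |].
exact: eval_ract.
Qed.

Lemma eval_var a i : eval a (var i) = a i.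
Proof. by rewrite eval_basis word_evalE gbase0 lact1 ract1. Qed.

End Evaluation.

Lemma free_word_eval (F : fieldType) (u : word) :
  word_eval (@var F) u = basis u :> {malg F[word]}.
Proof.
case: u => [[[w0 j] s] w]; rewrite word_evalE.
have lv v i : @lact _ _ (freeEX F) (gbase v) (var i) =
    basis ((v, i), [::], fset0) :> {malg F[word]}.
  apply: etrans (free_lactU _ _) _.
  by rewrite word_lactE gbase0 mulr1 linextU.
have step1 t v i : word_step (@var F) (basis ((w0, j), t, fset0) : freeEX F)
    (v, i) = basis ((w0, j), t ++ [:: (v, i)], fset0) :> {malg F[word]}.
  rewrite /word_step (lv v i); apply: etrans (free_mulUU _ _) _.
  by rewrite word_mulE gbase0 mul1r linextU.
have st t t' : foldl (word_step (@var F))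
   (basis ((w0, j), t, fset0) : freeEX F) t' =
   basis ((w0, j), t ++ t', fset0) :> {malg F[word]}.
  elim: t' t => [|[v i] t' IHt] t; first by rewrite cats0.
  rewrite -cat_rcons -cats1; apply: etrans (IHt _).
  exact: (f_equal (fun x => foldl _ x t') (step1 t v i)).
rewrite lv st; apply: etrans (free_ractU _ _) _.
by rewrite word_ractE gbase0 mul1r linextU.
Qed.

(* With [eval_whom] and [eval_var]: [freeEX F] is the free E-algebra on the
   [var i]. *)
Lemma eval_unique (F : fieldType) (A : wAlgebra (grassmann F))
    (phi : freeEX F -> A) :
  whom phi -> phi =1 eval (fun i => phi (var i)).
Proof.
move=> [pl pm pL pR]; apply: malg_lin_ext => //; first exact: eval_linear.
move=> u; rewrite eval_basis -free_word_eval.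
case: u => [[[w0 j] s] w]; rewrite !word_evalE pR; congr ract.
rewrite -pL; elim: s (lact _ _) => //= wj s IHs x.
by rewrite IHs /word_step pm pL.
Qed.

Definition IdE {F : fieldType} (A : wAlgebra (grassmann F)) (f : freeEX F) :
  Prop := forall a : nat -> A, eval a f = 0.

Definition multilinear {F : fieldType} (n : nat) (f : freeEX F) : Prop :=
  forall u : word, u \in msupp (f : {malg F[word]}) ->
    perm_eq (word_vars u) (iota 0 n).

(* dim P / (P /\ Q) = d, for subspaces P and Q of V: some d vectors of P form
   a basis of P modulo Q. *)
Definition quotient_dim {F : fieldType} {V : lmodType F} (P Q : V -> Prop)
    (d : nat) : Prop :=
  exists b : 'I_d -> V,
    [/\ forall i, P (b i),
        forall f, P f -> exists c : 'I_d -> F, Q (f - \sum_i c i *: b i)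
      & forall c : 'I_d -> F, Q (\sum_i c i *: b i) -> forall i, c i = 0].

(* c_n^E(A) = d *)
Definition codimension {F : fieldType} (A : wAlgebra (grassmann F)) (n d : nat) :
  Prop := quotient_dim (V := freeEX F) (multilinear n) (IdE A) d.

Section Generators.
Context {F : fieldType}.
Local Notation x i := (var i : freeEX F).

Variant E_trivial : freeEX F -> Prop :=
  | E_trivial_even (s : seq nat) of ~~ odd (size s) :
      E_trivial (rcomm (x 0%N) (\prod_(i <- s) gen i))
  | E_trivial_gen (i j : nat) :
      E_trivial (rcomm (lcomm (gen i) (x 0%N)) (gen j)).

(* Since generators are numbered from 0, e_1, ..., e_k are the [gen i] with
   i < k. *)
Variant grassmannK_gen (k : nat) : freeEX F -> Prop :=
  | gen_comm3 : grassmannK_gen k (wcomm (wcomm (x 0%N) (x 1%N)) (x 2%N))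
  | gen_lcomm (i : nat) of (i < k)%N :
      grassmannK_gen k (wcomm (lcomm (gen i) (x 0%N)) (x 1%N))
  | gen_lact (j : nat) of (k <= j)%N :
      grassmannK_gen k (lact (gen j) (x 0%N))
  | gen_ract (j : nat) of (k <= j)%N :
      grassmannK_gen k (ract (x 0%N) (gen j)).

End Generators.

(* Main.v *)
Require Import Defs.
From Stdlib Require Import Setoid Morphisms.
From HB Require Import structures.
From mathcomp Require Import all_boot all_order all_algebra.
From mathcomp Require Import zify.
From mathcomp Require Import finmap.
From mathcomp Require Import multinomials.monalg.

Set Implicit Arguments.
Unset Strict Implicit.
Unset Printing Implicit Defensive.

Import GRing.Theory.
Local Open Scope ring_scope.

(** Put E and the free algebra E<X> into one unital algebra U = E + E<X>, with
    the letters e_1, ..., e_k and x_1, x_2, ...  Let I be a T_E-ideal of E<X>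
    containing the generating polynomials, and work in U modulo I and the kernel
    of theta_k.  Every triple commutator [a, b, c] of letters vanishes there
    ([letter_like_central]), hence [a, b][c, d] = - [a, c][b, d]
    ([letter_like_swap]), because [a, bc, d] vanishes too.  A product of
    brackets [l_1, l_2][l_3, l_4]... is thus a central alternating function of
    its letters.  Moving letters past each other at the cost of such brackets,
    one reduces every word to a combination of normal forms: a product of
    variables in nondecreasing order, times a product of brackets of strictly
    increasing letters.  A further generator e_i may stand in front of the
    brackets; then the letters are odd in number, and the rule
    e_i [e_j, y] = - e_j [e_i, y] lets e_i be taken smallest.  This is
    [nf_span_mull], applied to words in [span_word].

    Conversely, the valid normal forms are linearly independent as functions on
    E^(k) ([nf_independent]).  Substitute x_j = t_j + e_(k+j) if x_j occurs in
    the brackets of a fixed normal form whose brackets involve as few variables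
    as possible, and x_j = t_j otherwise.  A bracket [a, b] becomes twice the
    product of the odd parts of a and b, so every normal form of the
    combination whose bracket variables are not the fixed ones vanishes, and the
    others become distinct basis vectors of E with coefficients monomials in
    the t_j.  Such monomials are independent over an infinite field.

    An identity of E^(k) is therefore congruent to a combination of normal
    forms, all of whose coefficients are zero, modulo the T_E-ideal spanned by
    the generating polynomials ([IdE_generated]); these are identities by
    [generators_IdE].  The multilinear normal forms in n variables form a basis
    of the multilinear polynomials modulo identities
    ([codimension_grassmannK]).  Such a form is determined by the set of letters
    in its last factor, a subset of the k + n letters which is even or contains
    some e_i.  Only the 2^(n-1) odd sets of variables are excluded, and
    2^(k+n) - 2^(n-1) = 2^(n-1) (2^(k+1) - 1).

    Letters are encoded as natural numbers: with generators and variables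
    numbered from 0, l < k stands for the generator [gen l] and l >= k for the
    variable [var (l - k)].  The usual order of nat then puts the generators
    first, and under the substitution above the odd part of every letter l is
    [gen l] or 0. *)

(** * Commutators in a ring *)

Definition commr (R : pzRingType) (a b : R) : R := a * b - b * a.

Section CommutatorIdentities.
Context {R : pzRingType}.
Implicit Types a b c d : R.

Lemma commr_anti a b : commr a b = - commr b a.
Proof. by rewrite /commr opprB. Qed.

Lemma commr_oppl a b : commr (- a) b = - commr a b.
Proof. by rewrite /commr mulNr mulrN opprB opprK addrC. Qed.

Lemma commr_jacobi a b c :
  commr (commr a b) c = commr (commr a c) b - commr (commr b c) a.
Proof.
rewrite /commr !(mulrBl, mulrBr) !(opprD, opprK) !mulrA !addrA.
by rewrite [RHS](ACl (7*3*2*6*1*8*4*5)) /= !addrK.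
Qed.

Lemma commr_addl a b c : commr (a + b) c = commr a c + commr b c.
Proof. by rewrite /commr mulrDl mulrDr opprD addrACA. Qed.

Lemma commr_addr a b c : commr a (b + c) = commr a b + commr a c.
Proof. by rewrite /commr mulrDl mulrDr opprD addrACA. Qed.

Lemma commr_subr a b c : commr a (b - c) = commr a b - commr a c.
Proof. by rewrite /commr mulrBl mulrBr !opprD !opprK addrACA. Qed.

Lemma commr_mulr a b c : commr a (b * c) = commr a b * c + b * commr a c.
Proof. by rewrite /commr mulrBl mulrBr !mulrA addrA subrK. Qed.

(** If triple commutators of letters and [a, bc, d] vanish, then so does the
    left-hand side, so that a product of two commutators changes sign when
    letters are exchanged across them. *)
Lemma commr_product a b c d :
  commr a b * commr c d + commr b d * commr a c =
  commr (commr a (b * c)) d - commr (commr a b) d * c - b * commr (commr a c) d.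
Proof.
rewrite /commr !(mulrBl, mulrBr) !(opprD, opprK) !mulrA !addrA.
by rewrite [RHS](ACl (1*5*9*6*11*12*8*4*7*3*10*2)) /= !addrK.
Qed.
End CommutatorIdentities.

Section Malg.
Context {F : fieldType} {K : choiceType}.
Implicit Types f : {malg F[K]}.

Lemma linext_basis f : linext basis f = f.
Proof.
move: f; apply: malg_lin_ext => [|//|k]; first exact: linext_linear.
by rewrite linextU.
Qed.

Lemma msupp_ex f : f != 0 -> exists k, k \in msupp f.
Proof.
move=> f_neq0; have /fset0Pn[k kf] : msupp f != fset0; last by exists k.
by apply: contraNneq f_neq0 => f0; rewrite (malgE_sum f) f0 big_seq_fset0.
Qed.
End Malg.

(** * Commutators in the Grassmann algebra *)

Section GrassmannCommutators.
Context {F : fieldType}.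
Local Notation E := (grassmann F).
Local Open Scope fset_scope.

(** Every pair of distinct elements is an inversion in exactly one of the two
    orders. *)
Lemma inversionsC (A B : {fset nat}) : [disjoint A & B] ->
  (inversions A B + inversions B A = #|` A| * #|` B|)%N.
Proof.
move=> dAB; rewrite /inversions [X in (_ + X)%N]exchange_big -big_split /=.
rewrite big_seq (eq_bigr (fun=> #|` B|)) => [|a aA].
  by rewrite -big_seq big_const_seq count_predT iter_addn_0 mulnC.
rewrite -big_split big_seq (eq_bigr (fun=> 1%N)) => [|b bB] /=.
  by rewrite -big_seq big_const_seq count_predT iter_addn_0 mul1n.
have : a != b.
  by apply: contraTneq aA => ->; apply: contraL bB => /(fdisjointP dAB).
by case: ltngtP.
Qed.

Lemma gbaseC (A B : {fset nat}) :
  gbase A * gbase B = (-1) ^+ (#|` A| * #|` B|) *: (gbase B * gbase A) :> E.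
Proof.
rewrite (gmulE A B) (gmulE B A) fdisjoint_sym.
have [dBA|_] := boolP [disjoint B & A]%fset; last by rewrite (@scaler0 F E).
rewrite (fsetUC A) (@scalerA F E); apply: (f_equal (fun c : F => c *: _)).
rewrite -inversionsC; last by rewrite fdisjoint_sym.
by rewrite exprD -mulrA -expr2 sqrr_sign mulr1.
Qed.

(** The commutator of two basis elements is nonzero only if both have odd
    length; then it is a multiple of a product of even length. *)
Lemma gcomm_central (a b c : E) : commr (commr a b) c = 0.
Proof.
have ml (y : E) : linear (fun x : E => x * y).
  by move=> d x z; rewrite mulrDl -scalerAl.
have mr (y : E) : linear (fun x : E => y * x).
  by move=> d x z; rewrite mulrDr -scalerAr.
have cl (y : E) : linear (fun x : E => commr x y).
  by move=> d x z; rewrite /commr (ml y) (mr y) scalerBr addrACA opprD.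
have cr (y : E) : linear (fun x : E => commr y x).
  by move=> d x z; rewrite /commr (ml y) (mr y) scalerBr addrACA opprD.
have z0 : linear (fun _ : E => 0 : E) by move=> d x y; rewrite scaler0 addr0.
move: a; apply: malg_lin_ext => //.
  exact: linear_comp (cl _) (cl _).
move=> A; move: b; apply: malg_lin_ext => //.
  exact: linear_comp (cl _) (cr _).
move=> B; move: c; apply: malg_lin_ext => // C.
rewrite -[basis A]/(gbase A : E) -[basis B]/(gbase B : E).
rewrite -[basis C]/(gbase C : E) /commr gbaseC -signr_odd oddM.
have [oA|eA] := boolP (odd #|` A|); last first.
  by rewrite scale1r subrr mul0r mulr0 subrr.
have [oB|eB] := boolP (odd #|` B|); last first.
  by rewrite scale1r subrr mul0r mulr0 subrr.
have odC D : odd #|` D| ->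
    gbase D * gbase C = (-1) ^+ #|` C| *: (gbase C * gbase D) :> E.
  by move=> oD; rewrite gbaseC -signr_odd oddM oD signr_odd.
have BAC : gbase B * gbase A * gbase C = gbase C * (gbase B * gbase A) :> E.
  rewrite -mulrA (odC _ oA) -scalerAr [in LHS]mulrA (odC _ oB) -scalerAl scalerA.
  by rewrite -expr2 sqrr_sign scale1r mulrA.
by rewrite expr1 scaleN1r mulrBl mulrBr mulNr mulrN BAC subrr.
Qed.

Lemma gen_gbase i (C : {fset nat}) :
  gen i * gbase C = (-1) ^+ #|` C| *: (gbase C * gen i) :> E.
Proof. by rewrite gbaseC cardfs1 mul1n. Qed.

Lemma gprod_central (s : seq nat) (b : E) : ~~ odd (size s) ->
  (\prod_(i <- s) gen i) * b = b * (\prod_(i <- s) gen i).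
Proof.
move=> es; move: b; apply: malg_lin_ext.
- by move=> d x z; rewrite mulrDr -scalerAr.
- by move=> d x z; rewrite mulrDl -scalerAl.
move=> C; rewrite -[basis C]/(gbase C : E).
have -> : (\prod_(i <- s) gen i) * gbase C =
    (-1) ^+ (#|` C| * size s) *: (gbase C * \prod_(i <- s) gen i) :> E.
  elim: s {es} => [|i s IHs].
    by rewrite big_nil muln0 scale1r mul1r mulr1.
  rewrite big_cons -mulrA IHs -scalerAr [in LHS]mulrA gen_gbase -scalerAl.
  by rewrite scalerA mulrA -(@exprD F) mulnS addnC.
by rewrite -signr_odd oddM (negbTE es) andbF scale1r.
Qed.
End GrassmannCommutators.

(** * Congruence modulo a two-sided ideal *)

Record ideal_pred (F : fieldType) (R : algType F) (I : R -> Prop) : Prop := {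
  ideal_pred0 : I 0;
  ideal_predD : forall a b, I a -> I b -> I (a + b);
  ideal_predMl : forall a b, I b -> I (a * b);
  ideal_predMr : forall a b, I a -> I (a * b) }.

Definition eqmod (F : fieldType) (R : algType F) (I : R -> Prop) (a b : R) :=
  I (a - b).

Section EqMod.
Context {F : fieldType} {R : algType F} {I : R -> Prop}.
Hypothesis idI : ideal_pred I.
Local Notation "a =~ b" := (eqmod I a b) (at level 70).

Lemma ideal_predZ c a : I a -> I (c *: a).
Proof. by move=> Ia; rewrite -mulr_algl; apply: (ideal_predMl idI). Qed.

Lemma ideal_predN a : I a -> I (- a).
Proof. by move=> Ia; rewrite -scaleN1r; apply: ideal_predZ. Qed.

Lemma eqmod_refl a : a =~ a.
Proof. by rewrite /eqmod subrr; apply: (ideal_pred0 idI). Qed.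

Lemma eqmod_sym a b : a =~ b -> b =~ a.
Proof. by move/ideal_predN; rewrite /eqmod opprB. Qed.

Lemma eqmod_trans a b c : a =~ b -> b =~ c -> a =~ c.
Proof. by move=> ab bc; have := ideal_predD idI ab bc; rewrite addrA subrK. Qed.

Lemma eqmodD a a' b b' : a =~ a' -> b =~ b' -> a + b =~ a' + b'.
Proof.
by move=> ab bc; have := ideal_predD idI ab bc; rewrite addrACA -opprD.
Qed.

Lemma eqmodN a a' : a =~ a' -> - a =~ - a'.
Proof. by move/ideal_predN; rewrite /eqmod opprB opprK addrC. Qed.

Lemma eqmodZ c a a' : a =~ a' -> c *: a =~ c *: a'.
Proof. by move/(ideal_predZ c); rewrite /eqmod scalerBr. Qed.

Lemma eqmodM a a' b b' : a =~ a' -> b =~ b' -> a * b =~ a' * b'.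
Proof.
move=> aa bb; apply: (@eqmod_trans _ (a' * b)).
  by have := ideal_predMr idI b aa; rewrite mulrBl.
by have := ideal_predMl idI a' bb; rewrite mulrBr.
Qed.

Lemma eqmod0 a : a =~ 0 <-> I a.
Proof. by rewrite /eqmod subr0. Qed.
End EqMod.

(** * Normal forms in an algebra with central commutators *)

Section Brackets.
Context {R : pzRingType}.

(** The value 0 on lists of odd length keeps this function alternating on lists
    of every length. *)
Fixpoint brackets (s : seq R) : R :=
  match s with
  | [::] => 1
  | [:: _] => 0
  | a :: b :: s' => commr a b * brackets s'
  end.

(** One of the two terms is zero by parity: the value is the product of the
    brackets for an even list, and the head times the brackets of the rest for
    an odd list. *)
Definition alternator (s : seq R) : R :=
  brackets s + head 0 s * brackets (behead s).

Lemma brackets_odd s : odd (size s) -> brackets s = 0.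
Proof.
elim/ltn_ind: {s}(size s) {-2}s (erefl (size s)) => n IH [|a [|b s]] //= sz.
by rewrite negbK => /(IH (size s)) -> //; rewrite ?mulr0 // -sz.
Qed.

End Brackets.

(** The letters of the leading product and those of the alternator. *)
Definition nf_index : Type := (seq nat * seq nat)%type.

Section NormalForm.
Context {F : fieldType} {R : algType F} {I : R -> Prop}.
Hypothesis idI : ideal_pred I.
Hypothesis two_neq0 : 2%:R != 0 :> F.
Variables (k : nat) (v : nat -> R).
Local Notation "a =~ b" := (eqmod I a b) (at level 70).
(* Letters l < k play the role of the generators of E, which anticommute; the
   other letters are variables. *)
Hypothesis v_central : forall a b c, commr (commr (v a) (v b)) (v c) =~ 0.
Hypothesis v_swap : forall a b c d,
  commr (v a) (v b) * commr (v c) (v d) =~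
  - (commr (v a) (v c) * commr (v b) (v d)).
Hypothesis v_anti : forall a b, (a < k)%N -> (b < k)%N ->
  v a * v b =~ - (v b * v a).

(* These instances make [rewrite] work with congruences. *)
Let eqmod_equiv : Equivalence (eqmod I).
Proof.
split=> [a|a b|a b c]; first exact: eqmod_refl.
  exact: eqmod_sym.
exact: eqmod_trans.
Qed.
Local Existing Instance eqmod_equiv.
Let add_mor : Proper (eqmod I ==> eqmod I ==> eqmod I) (@GRing.add R).
Proof. move=> a a' aa b b' bb; exact: (eqmodD idI aa bb). Qed.
Local Existing Instance add_mor.
Let mul_mor : Proper (eqmod I ==> eqmod I ==> eqmod I) (@GRing.mul R).
Proof. move=> a a' aa b b' bb; exact: (eqmodM idI aa bb). Qed.
Local Existing Instance mul_mor.
Let opp_mor : Proper (eqmod I ==> eqmod I) (@GRing.opp R).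
Proof. move=> a a' aa; exact: (eqmodN idI aa). Qed.
Local Existing Instance opp_mor.
Let scale_mor c : Proper (eqmod I ==> eqmod I) (@GRing.scale F R c).
Proof. move=> a a' aa; exact: (eqmodZ idI c aa). Qed.
Local Existing Instance scale_mor.

Let two_half : 2%:R^-1 + 2%:R^-1 = 1 :> F.
Proof. by rewrite -(mulr2n 2%:R^-1) -[LHS]mulr_natl mulfV. Qed.

(** Division by 2 is what makes an alternating expression with a repeated letter
    vanish, and what expresses a product of two anticommuting letters by their
    commutator. *)
Lemma eqmod_halve a b : a + a =~ b + b -> a =~ b.
Proof.
have half (x : R) : x = (2%:R^-1 : F) *: (x + x).
  by rewrite scalerDr -scalerDl two_half scale1r.
by move=> ab; rewrite (half a) (half b) ab; reflexivity.
Qed.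

Lemma eqmod_self_opp a : a =~ - a -> a =~ 0.
Proof.
move=> aN; apply: eqmod_halve; rewrite {1}aN addNr addr0; reflexivity.
Qed.

Lemma commr_prod a b (l : seq nat) :
  commr (v a) (v b) * (\prod_(i <- l) v i) =~
  (\prod_(i <- l) v i) * commr (v a) (v b).
Proof.
elim: l => [|c l IHl]; first by rewrite big_nil mul1r mulr1; reflexivity.
have cE : commr (v a) (v b) * v c =~ v c * commr (v a) (v b).
  by have := v_central a b c; rewrite {1}/commr => /(eqmod0 (I := I)).
by rewrite !big_cons mulrA cE -!mulrA IHl; reflexivity.
Qed.

(** Two adjacent letters belong either to one bracket, which changes sign, or to
    two consecutive brackets, where [v_swap] applies. *)
Lemma brackets_swap l1 x y l2 :
  brackets (map v (l1 ++ x :: y :: l2)) =~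
  - brackets (map v (l1 ++ y :: x :: l2)).
Proof.
elim/ltn_ind: {l1}(size l1) {-2}l1 (erefl (size l1)) => n IH [|a [|b l1]] /= sz.
- by rewrite commr_anti mulNr; reflexivity.
- case: l2 {IH} => [|b l2] /=; first by rewrite !mulr0 oppr0; reflexivity.
  by rewrite !mulrA v_swap mulNr; reflexivity.
by rewrite (IH (size l1)) // -?sz // mulrN; reflexivity.
Qed.

Lemma brackets_dup l1 x l2 : brackets (map v (l1 ++ x :: x :: l2)) =~ 0.
Proof. exact/eqmod_self_opp/brackets_swap. Qed.

Lemma brackets_insert x l l1 : sorted leq l ->
  exists c : F, brackets (map v (l1 ++ x :: l)) =~
    c *: brackets (map v (l1 ++ sort leq (x :: l))).
Proof.
have tl : transitive leq by move=> a b d; exact: leq_trans.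
elim: l l1 => [|y l IHl] l1 sl.
  by exists 1; rewrite scale1r; reflexivity.
have [xy|yx] := leqP x y.
  exists 1; rewrite scale1r sorted_sort //=; first by reflexivity.
  by rewrite xy.
have [c cE] := IHl (rcons l1 y) (path_sorted sl).
exists (- c); rewrite brackets_swap -cat_rcons cE -scaleNr cat_rcons.
suff -> : sort leq (x :: y :: l) = y :: sort leq (x :: l) by reflexivity.
apply: (sorted_eq tl anti_leq); first exact: (sort_sorted leq_total).
  rewrite /= path_sortedE // sort_sorted ?andbT; last exact: leq_total.
  rewrite all_sort /= ltnW //=; exact: (order_path_min tl sl).
rewrite perm_sort (perm_catCA [:: x] [:: y] l) /= perm_cons perm_sym.
by rewrite perm_sort.
Qed.

Lemma brackets_sort l l1 :
  exists c : F, brackets (map v (l1 ++ l)) =~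
    c *: brackets (map v (l1 ++ sort leq l)).
Proof.
elim: l l1 => [|x l IHl] l1; first by exists 1; rewrite scale1r; reflexivity.
have [c cE] := IHl (rcons l1 x).
have [d dE] := @brackets_insert x (sort leq l) l1 (sort_sorted leq_total l).
exists (c * d); rewrite -cat_rcons cE cat_rcons dE scalerA.
suff -> : sort leq (x :: sort leq l) = sort leq (x :: l) by reflexivity.
apply/perm_sortP; [exact: leq_total|exact: leq_trans|exact: anti_leq|].
by rewrite perm_cons perm_sort.
Qed.

Lemma sorted_leq_dup (l : seq nat) : sorted leq l -> ~~ uniq l ->
  exists l1 x l2, l = l1 ++ x :: x :: l2.
Proof.
elim: l => [|x [|y l] IHl] //= /andP[xy sl].
have [->|nxy] := eqVneq x y; first by exists [::], y, l.
have xn : x \notin y :: l.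
  apply/negP => /= xi; have := order_path_min leq_trans sl.
  move: xi; rewrite inE (negbTE nxy) /= => xl /allP/(_ x xl) yx.
  by rewrite eqn_leq xy yx in nxy.
rewrite xn /= => nu; have [l1 [z [l2 E]]] := IHl sl nu.
by exists (x :: l1), z, l2; rewrite E.
Qed.

(** Since brackets alternate, sorting the letters costs only a sign, recorded as
    a scalar that can be taken to be 0 when a letter is repeated. *)
Lemma brackets_normal l : exists c : F,
  brackets (map v l) =~ c *: brackets (map v (sort leq l)) /\
  (~~ uniq l -> c = 0).
Proof.
have [c cE] := brackets_sort l [::].
have [ul|nul] := boolP (uniq l); first by exists c.
exists 0; split=> //; rewrite cE scale0r.
have [|l1 [x [l2 ->]]] := @sorted_leq_dup (sort leq l) (sort_sorted leq_total l).
  by rewrite sort_uniq.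
by rewrite brackets_dup scaler0; reflexivity.
Qed.

Lemma commr0P a b : commr a b =~ 0 <-> a * b =~ b * a.
Proof. by rewrite /commr /eqmod subr0. Qed.

(** For small letters 2 v_i v_j is congruent to the commutator [v_i, v_j], hence
    v_i v_j is central, and [v_i v_j, v_y] = v_i [v_j, v_y] + [v_i, v_y] v_j
    vanishes. *)
Lemma small_letter_swap i j y : (i < k)%N -> (j < k)%N ->
  v i * commr (v j) (v y) =~ - (v j * commr (v i) (v y)).
Proof.
move=> ik jk.
have cc a b c : commr (v a) (v b) * v c =~ v c * commr (v a) (v b).
  exact/commr0P.
have ijE : commr (v i) (v j) =~ v i * v j + v i * v j.
  by rewrite /commr (v_anti jk ik) opprK; reflexivity.
have ijy : v i * v j * v y =~ v y * (v i * v j).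
  by apply: eqmod_halve; rewrite -mulrDl -(mulrDr (v y)) -ijE.
have E : v i * commr (v j) (v y) + commr (v i) (v y) * v j =
    v i * v j * v y - v y * (v i * v j).
  by rewrite /commr mulrBr mulrBl !mulrA addrA subrK.
have : v i * commr (v j) (v y) + commr (v i) (v y) * v j =~ 0.
  by rewrite E ijy subrr; reflexivity.
by rewrite cc /eqmod subr0 opprK.
Qed.

Definition normal_form (p : nf_index) : R :=
  (\prod_(l <- p.1) v l) * alternator (map v p.2).

(** An alternator of odd length begins with a letter outside all brackets.  This
    letter has to be small: x [y, z] is not alternating in three variables. *)
Definition nf_valid (p : nf_index) : bool :=
  [&& sorted leq p.1, all (leq k) p.1, sorted ltn p.2 &
      odd (size p.2) ==> (head k p.2 < k)%N].

(** The multidegree in the variables, as a list with multiplicities. *)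
Definition nf_degree (p : nf_index) : seq nat :=
  p.1 ++ [seq l <- p.2 | (k <= l)%N].

Definition nf_comb (D : nf_index -> Prop) (b : R) : Prop :=
  exists2 m : {malg F[nf_index]},
    forall p, p \in msupp m -> D p & b =~ linext normal_form m.

Lemma nf_comb_eqmod D b b' : b =~ b' -> nf_comb D b' -> nf_comb D b.
Proof. by move=> bb [m mP mE]; exists m => //; rewrite bb. Qed.

Lemma nf_comb_sub (D D' : nf_index -> Prop) b :
  (forall p, D p -> D' p) -> nf_comb D b -> nf_comb D' b.
Proof. by move=> DD [m mP mE]; exists m => // p /mP/DD. Qed.

Lemma nf_comb0 D : nf_comb D 0.
Proof.
by exists 0 => [p|]; rewrite ?msupp0 ?inE // linear0; reflexivity.
Qed.

Lemma nf_combZD D c a b : nf_comb D a -> nf_comb D b -> nf_comb D (c *: a + b).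
Proof.
move=> [m mP mE] [n nP nE]; exists (c *: m + n) => [p|]; last first.
  by rewrite mE nE linearP; reflexivity.
move/(fsubsetP (msuppD_le _ _)); rewrite in_fsetU => /orP[|/nP//].
by move/(fsubsetP (msuppZ_le _ _))/mP.
Qed.

Lemma nf_combZ D c a : nf_comb D a -> nf_comb D (c *: a).
Proof.
by move=> sa; rewrite -[_ *: _]addr0; apply: nf_combZD => //; apply: nf_comb0.
Qed.

Lemma nf_combD D a b : nf_comb D a -> nf_comb D b -> nf_comb D (a + b).
Proof. by move=> sa; rewrite -[a]scale1r; apply: nf_combZD. Qed.

Lemma nf_comb_linext D (K : choiceType) (f : K -> R) (m : {malg F[K]}) :
  (forall p, p \in msupp m -> nf_comb D (f p)) -> nf_comb D (linext f m).
Proof.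
move=> sf; rewrite linextE big_seq.
elim/big_ind: _ => [|a b|p /sf]; first exact: nf_comb0.
  exact: nf_combD.
exact: nf_combZ.
Qed.

Definition nf_span (s : seq nat) : R -> Prop :=
  nf_comb (fun p => nf_valid p && perm_eq (nf_degree p) s).

Lemma nf_span_perm s t b : perm_eq s t -> nf_span s b -> nf_span t b.
Proof.
move=> st; apply: nf_comb_sub => p /andP[-> ps] /=.
exact: perm_trans ps st.
Qed.

Lemma nf_span_nf p : nf_valid p -> nf_span (nf_degree p) (normal_form p).
Proof.
move=> vp; exists (basis p) => [q|]; last by rewrite linextU; reflexivity.
rewrite basisE msuppU oner_eq0 inE => /eqP->.
by rewrite vp perm_refl.
Qed.

Lemma brackets_eq0 l : odd (size l) -> brackets (map v l) = 0.
Proof. by move=> ol; rewrite brackets_odd // size_map. Qed.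

(** Sorting the letters of the brackets gives a normal form or 0. *)
Lemma nf_brackets a l : sorted leq a -> all (leq k) a ->
  nf_span (a ++ filter (leq k) l) ((\prod_(i <- a) v i) * brackets (map v l)).
Proof.
move=> sa ka; have [ol|el] := boolP (odd (size l)).
  by rewrite brackets_eq0 // mulr0; apply: nf_comb0.
have [c [cE c0]] := brackets_normal l.
apply: (@nf_comb_eqmod _ _ (c *: normal_form (a, sort leq l))).
  rewrite cE -scalerAr /normal_form /alternator /=.
  case: (sort leq l) (size_sort leq l) => [|x l'] /= sl.
    by rewrite mul0r addr0; reflexivity.
  have ol : odd (size l') by move: el; rewrite -sl /= negbK.
  by rewrite (brackets_eq0 ol) mulr0 addr0; reflexivity.
have [ul|/c0->] := boolP (uniq l); last by rewrite scale0r; apply: nf_comb0.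
apply: nf_combZ; apply: (@nf_span_perm (nf_degree (a, sort leq l))).
  by rewrite /nf_degree perm_cat2l perm_filter //= perm_sort.
apply: nf_span_nf; rewrite /nf_valid /= sa ka size_sort (negbTE el) andbT.
by rewrite ltn_sorted_uniq_leq sort_uniq ul sort_sorted //; apply: leq_total.
Qed.

Lemma nf_small_brackets_sorted a i l : sorted leq a -> all (leq k) a ->
  (i < k)%N -> sorted ltn (i :: l) -> ~~ odd (size l) ->
  nf_span (a ++ filter (leq k) l)
    ((\prod_(i <- a) v i) * (v i * brackets (map v l))).
Proof.
move=> sa ka ik sl el.
have -> : (\prod_(i <- a) v i) * (v i * brackets (map v l)) =
    normal_form (a, i :: l).
  by rewrite /normal_form /alternator (brackets_eq0 (l := i :: l)) //= add0r.
have -> : filter (leq k) l = filter (leq k) (i :: l) by rewrite /= leqNgt ik.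
apply: (nf_span_nf (p := (a, i :: l))).
by rewrite /nf_valid sa ka sl /= ik implybT.
Qed.

(** If some letter of the brackets is smaller than i it is small as well, and
    [small_letter_swap] exchanges the two before the rest is sorted. *)
Lemma nf_small_brackets a i l : sorted leq a -> all (leq k) a -> (i < k)%N ->
  nf_span (a ++ filter (leq k) l)
    ((\prod_(i <- a) v i) * (v i * brackets (map v l))).
Proof.
move=> sa ka ik; have [ol|el] := boolP (odd (size l)).
  by rewrite brackets_eq0 // !mulr0; apply: nf_comb0.
have [c [cE c0]] := brackets_normal l.
apply: (@nf_comb_eqmod _ _
    (c *: ((\prod_(i <- a) v i) * (v i * brackets (map v (sort leq l)))))).
  by rewrite cE -!scalerAr; reflexivity.
have [ul|/c0->] := boolP (uniq l); last by rewrite scale0r; apply: nf_comb0.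
apply: nf_combZ; apply: (@nf_span_perm (a ++ filter (leq k) (sort leq l))).
  by rewrite /nf_degree perm_cat2l perm_filter //= perm_sort.
have sl : sorted ltn (sort leq l).
  by rewrite ltn_sorted_uniq_leq sort_uniq ul sort_sorted //; apply: leq_total.
move: el sl; rewrite -(size_sort leq).
move: (sort leq l) => {}l {c cE c0 ul} el sl.
case: l el sl => [|j l] el sl; first exact: nf_small_brackets_sorted.
have [ij|ji|eij] := ltngtP i j.
- by apply: nf_small_brackets_sorted; rewrite //= ij.
- case: l el sl => [//|y l] /= el /andP[jy sl].
  (* j becomes the letter in front and i joins the brackets. *)
  have jk := ltn_trans ji ik.
  have [d [dE d0]] := brackets_normal (i :: y :: l).
  apply: (@nf_comb_eqmod _ _ (- d *: ((\prod_(i <- a) v i) *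
      (v j * brackets (map v (sort leq (i :: y :: l))))))).
    rewrite (mulrA (v i)) (small_letter_swap y ik jk) mulNr -(mulrA (v j)).
    by rewrite -[X in - (v j * X)]/(brackets (map v (i :: y :: l))) dE
      -!scalerAr mulrN scaleNr -scalerAr; reflexivity.
  have [ul|/d0->] := boolP (uniq (i :: y :: l)); last first.
    by rewrite oppr0 scale0r; apply: nf_comb0.
  apply: nf_combZ.
  apply: (@nf_span_perm (a ++ filter (leq k) (sort leq (i :: y :: l)))).
    rewrite perm_cat2l; apply: (@perm_trans _ (filter (leq k) (i :: y :: l))).
      by apply: perm_filter; rewrite perm_sort.
    by rewrite /= (leqNgt k i) (leqNgt k j) ik jk.
  apply: nf_small_brackets_sorted => //; last by rewrite size_sort.
  rewrite /= path_sortedE ?all_sort; last exact: ltn_trans.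
  have /= -> : all (ltn j) (i :: y :: l).
    rewrite /= ji; apply: (@order_path_min _ ltn j (y :: l) ltn_trans).
    by rewrite /= jy.
  by rewrite ltn_sorted_uniq_leq sort_uniq ul sort_sorted //; apply: leq_total.
case: l el sl => [//|y l] /= el /andP[jy sl].
apply: nf_comb_eqmod (nf_comb0 _).
suff -> : v i * (commr (v j) (v y) * brackets (map v l)) =~ 0.
  by rewrite mulr0; reflexivity.
rewrite (mulrA (v i)) -eij (eqmod_self_opp (small_letter_swap y ik ik)) mul0r.
reflexivity.
Qed.

(** A new letter y is moved to the right through the sorted product of variables,
    up to its place if it is a variable and up to beta if it is small.  Passing
    a variable x creates the central factor [y, x], absorbed by beta; what
    remains of the sorted product is still sorted.  Here beta is either the
    product of brackets or this product preceded by a small letter. *)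
Lemma nf_push (beta : seq nat -> R) :
  (forall y x l, commr (v y) (v x) * beta l =~ beta (y :: x :: l)) ->
  (forall a l, sorted leq a -> all (leq k) a ->
     nf_span (a ++ filter (leq k) l) ((\prod_(i <- a) v i) * beta l)) ->
  (forall y a l, (y < k)%N -> sorted leq a -> all (leq k) a ->
     nf_span (a ++ filter (leq k) l) ((\prod_(i <- a) v i) * (v y * beta l))) ->
  forall y l a p, sorted leq (p ++ a) -> all (leq k) (p ++ a) ->
    ((k <= y)%N -> all (geq y) p) ->
    nf_span (filter (leq k) [:: y] ++ (p ++ a) ++ filter (leq k) l)
      ((\prod_(i <- p) v i) * (v y * ((\prod_(i <- a) v i) * beta l))).
Proof.
move=> beta_br beta_big beta_small y l; elim=> [|i a IHa] p.
  rewrite cats0 => sp kp yp; rewrite big_nil mul1r /=.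
  have [yk|ky] := ltnP y k; first exact: beta_small.
  rewrite mulrA -big_rcons /= -cats1.
  apply: (@nf_span_perm ((p ++ [:: y]) ++ filter (leq k) l)).
    by rewrite -catA perm_catCA.
  apply: beta_big; last by rewrite all_cat kp /= ky.
  rewrite sorted_pairwise ?pairwise_cat /=; last exact: leq_trans.
  rewrite allrel1r (yp ky) /= andbT -sorted_pairwise //.
  by move=> ? ? ?; apply: leq_trans.
move=> sp kp yp.
(* Either y is a variable that fits between p and i, or it has to pass i. *)
have [/andP[ky yi]|nyi] := boolP ((k <= y) && (y <= i))%N.
  apply: (@nf_span_perm ((p ++ y :: i :: a) ++ filter (leq k) l)).
    by rewrite /= ky; apply/permP => P; rewrite !count_cat /=; lia.
  have -> : (\prod_(i <- p) v i) * (v y * ((\prod_(i <- i :: a) v i) * beta l)) =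
      (\prod_(i <- p ++ y :: i :: a) v i) * beta l.
    by rewrite big_cat /= (big_cons _ _ y) /= !mulrA.
  apply: beta_big; last by move: kp; rewrite !all_cat /= ky.
  have tl : transitive leq by move=> ? ? ?; apply: leq_trans.
  move: sp; rewrite !(sorted_pairwise tl) !pairwise_cat (allrel_consr _ p y).
  have -> : all (leq^~ y) p by exact: yp ky.
  rewrite /=.
  move=> /and3P[-> -> /andP[ia ->]]; rewrite yi ia /= andbT.
  by apply: sub_all ia => j; apply: leq_trans.
have yiE : v y * v i = v i * v y + commr (v y) (v i) by rewrite addrC subrK.
have E : (\prod_(i <- p) v i) * (v y * ((\prod_(i <- i :: a) v i) * beta l)) =~
   (\prod_(i <- rcons p i) v i) * (v y * ((\prod_(i <- a) v i) * beta l)) +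
   (\prod_(i <- p ++ a) v i) * beta (y :: i :: l).
  rewrite big_cons -(mulrA (v i)) (mulrA (v y)) yiE mulrDl mulrDr.
  rewrite (mulrA (commr _ _)) commr_prod -(mulrA _ (commr _ _)) beta_br.
  by rewrite -cats1 !big_cat big_seq1 !mulrA; reflexivity.
apply: nf_comb_eqmod E _; apply: nf_combD.
  have -> : p ++ i :: a = rcons p i ++ a by rewrite cat_rcons.
  apply: IHa; rewrite ?cat_rcons // => ky; rewrite all_rcons yp // andbT.
  by move: nyi; rewrite ky -ltnNge => /ltnW.
have ki : (k <= i)%N by move: kp; rewrite all_cat /= => /and3P[].
have sub : subseq (p ++ a) (p ++ i :: a) by rewrite cat_subseq // subseq_cons.
apply: (@nf_span_perm ((p ++ a) ++ filter (leq k) (y :: i :: l))).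
  apply/permP => P; rewrite !count_cat /= ki.
  by case: (leqP k y) => _ /=; lia.
apply: beta_big; first exact: (subseq_sorted leq_trans sub).
by move: kp; rewrite !all_cat /= => /and3P[-> _ ->].
Qed.

Lemma nf_span1 : nf_span [::] 1.
Proof.
have -> : 1 = normal_form ([::], [::]).
  by rewrite /normal_form /alternator big_nil /= mul0r addr0 mulr1.
exact: (nf_span_nf (p := ([::], [::]))).
Qed.

Lemma nf_mull_brackets y a l : sorted leq a -> all (leq k) a ->
  nf_span (filter (leq k) [:: y] ++ a ++ filter (leq k) l)
    (v y * ((\prod_(i <- a) v i) * brackets (map v l))).
Proof.
move=> sa ka.
have br y1 x1 l1 : commr (v y1) (v x1) * brackets (map v l1) =~
    brackets (map v (y1 :: x1 :: l1)) by exact: eqmod_refl.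
have := nf_push br (@nf_brackets)
  (fun y1 a1 l1 yk sa1 ka1 => nf_small_brackets l1 sa1 ka1 yk)
  (y := y) l (a := a) (p := [::]) sa ka.
by rewrite big_nil mul1r; apply.
Qed.

Lemma nf_mull_small_brackets y a h l : sorted leq a -> all (leq k) a ->
  (h < k)%N -> nf_span (filter (leq k) [:: y] ++ a ++ filter (leq k) l)
    (v y * ((\prod_(i <- a) v i) * (v h * brackets (map v l)))).
Proof.
move=> sa ka hk.
have := @nf_push (fun l => v h * brackets (map v l)) _ _ _ y l a [::] sa ka.
rewrite big_nil mul1r; apply=> // [y1 x1 l1|a1 l1 sa1 ka1|].
- rewrite /= !mulrA.
  have /commr0P-> := v_central y1 x1 h; reflexivity.
- exact: nf_small_brackets.
move=> y1 a1 l1 yk sa1 ka1.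
have yhE : v y1 * v h =~ 2%:R^-1 *: commr (v y1) (v h).
  apply: eqmod_halve; rewrite -scalerDl two_half scale1r /commr.
  by rewrite (v_anti hk yk) opprK; reflexivity.
apply: (@nf_comb_eqmod _ _ (2%:R^-1 *:
    ((\prod_(i <- a1) v i) * brackets (map v (y1 :: h :: l1))))).
  by rewrite (mulrA (v y1)) yhE -scalerAl -scalerAr; reflexivity.
apply: nf_combZ.
have -> : filter (leq k) l1 = filter (leq k) (y1 :: h :: l1).
  by rewrite /= (leqNgt k y1) (leqNgt k h) yk hk.
exact: nf_brackets.
Qed.

(** The span of the normal forms is a left ideal; since it contains 1, it
    contains every product of letters. *)
Lemma nf_span_mull y s b : nf_span s b ->
  nf_span (filter (leq k) [:: y] ++ s) (v y * b).
Proof.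
move=> [m mP mE].
have linM : linear (fun x => v y * x).
  by move=> c a d; rewrite mulrDr -scalerAr.
apply: (@nf_comb_eqmod _ _ (linext (fun p => v y * normal_form p) m)).
  by rewrite mE -(linear_linext normal_form m linM); reflexivity.
apply: nf_comb_linext => -[a l] /mP /andP[/and4P[/= sa ka sl ol] dp].
apply: (@nf_span_perm (filter (leq k) [:: y] ++ nf_degree (a, l))).
  by rewrite perm_cat2l.
rewrite /normal_form /alternator /nf_degree /= !mulrDr.
apply: nf_combD; first exact: nf_mull_brackets.
case: l ol {sl dp} => [|h l] /= ol.
  by rewrite mul0r !mulr0; apply: nf_comb0.
have [ol'|el] := boolP (odd (size l)).
  by rewrite brackets_eq0 // !mulr0; apply: nf_comb0.
move: ol; rewrite el /= => hk; rewrite (leqNgt k h) hk.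
exact: nf_mull_small_brackets.
Qed.

End NormalForm.

(** * The unital algebra W + A of a W-algebra A *)

(** Words of the free W-algebra begin and end with coefficients in W.  In this
    algebra they are products of letters, and a T_W-ideal of A becomes part of
    an ordinary two-sided ideal. *)
Definition unitization (F : fieldType) (W : algType F) (A : wAlgebra W) : Type :=
  (W * A)%type.

Section Unitization.
Context {F : fieldType} {W : algType F} {A : wAlgebra W}.
Local Notation U := (unitization A).

HB.instance Definition _ := GRing.Lmodule.on U.

Definition unit_mul (a b : U) : U :=
  (a.1 * b.1, lact a.1 b.2 + ract a.2 b.1 + wmul a.2 b.2).

Definition unit_one : U := (1, 0).

Let lactDl (a : A) (w w' : W) : lact (w + w') a = lact w a + lact w' a.
Proof. by have := lact_linear_l a 1 w w'; rewrite !scale1r. Qed.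
Let lactDr (w : W) (a b : A) : lact w (a + b) = lact w a + lact w b.
Proof. by have := lact_linear_r w 1 a b; rewrite !scale1r. Qed.
Let ractDl (a b : A) (w : W) : ract (a + b) w = ract a w + ract b w.
Proof. by have := ract_linear_l w 1 a b; rewrite !scale1r. Qed.
Let ractDr (a : A) (w w' : W) : ract a (w + w') = ract a w + ract a w'.
Proof. by have := ract_linear_r a 1 w w'; rewrite !scale1r. Qed.
Let wmulDl (a b c : A) : wmul (a + b) c = wmul a c + wmul b c.
Proof. by have := wmul_linear_l c 1 a b; rewrite !scale1r. Qed.
Let wmulDr (a b c : A) : wmul a (b + c) = wmul a b + wmul a c.
Proof. by have := wmul_linear_r a 1 b c; rewrite !scale1r. Qed.

Lemma unit_mulA : associative unit_mul.
Proof.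
move=> [u a] [v b] [w c]; rewrite /unit_mul /=; congr pair; first exact: mulrA.
rewrite !lactDr !ractDl !wmulDl !wmulDr lactM ractM lact_ract wmul_ract.
rewrite lact_wmul ract_wmul wmulA.
by rewrite !addrA [LHS](ACl (1*2*4*6*3*5*7)).
Qed.

Lemma unit_mul1 : left_id unit_one unit_mul.
Proof.
move=> [u a]; rewrite /unit_mul /= mul1r lact1.
by rewrite (lin0 (ract_linear_l u)) (lin0 (wmul_linear_l a)) !addr0.
Qed.

Lemma unit_1mul : right_id unit_one unit_mul.
Proof.
move=> [u a]; rewrite /unit_mul /= mulr1 ract1.
by rewrite (lin0 (lact_linear_r u)) (lin0 (wmul_linear_r a)) add0r addr0.
Qed.

Lemma unit_mulDl : left_distributive unit_mul +%R.
Proof.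
move=> [u a] [v b] [w c]; rewrite /unit_mul /= mulrDl lactDl ractDl wmulDl.
by congr pair; rewrite !addrA [LHS](ACl (1*3*5*2*4*6)).
Qed.

Lemma unit_mulDr : right_distributive unit_mul +%R.
Proof.
move=> [u a] [v b] [w c]; rewrite /unit_mul /= mulrDr lactDr ractDr wmulDr.
by congr pair; rewrite !addrA [LHS](ACl (1*3*5*2*4*6)).
Qed.

Lemma unit_one_neq0 : unit_one != 0.
Proof. by rewrite -pair_eqE /= oner_eq0. Qed.

HB.instance Definition _ := GRing.Zmodule_isNzRing.Build U
  unit_mulA unit_mul1 unit_1mul unit_mulDl unit_mulDr unit_one_neq0.

Lemma unit_mulE (a b : U) :
  a * b = (a.1 * b.1, lact a.1 b.2 + ract a.2 b.1 + wmul a.2 b.2).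
Proof. by []. Qed.

Lemma unit_scaleAl (c : F) (a b : U) : c *: (a * b) = (c *: a) * b.
Proof.
case: a b => [u a] [v b]; rewrite !unit_mulE /=.
rewrite (linZ (lact_linear_l b)) (linZ (ract_linear_l v)).
rewrite (linZ (wmul_linear_l b)) -!scalerDr -scalerAl.
by [].
Qed.

HB.instance Definition _ := GRing.Lmodule_isLalgebra.Build F U unit_scaleAl.

Lemma unit_scaleAr (c : F) (a b : U) : c *: (a * b) = a * (c *: b).
Proof.
case: a b => [u a] [v b]; rewrite !unit_mulE /=.
rewrite (linZ (lact_linear_r u)) (linZ (ract_linear_r a)).
rewrite (linZ (wmul_linear_r a)) -!scalerDr -scalerAr.
by [].
Qed.

HB.instance Definition _ := GRing.Lalgebra_isAlgebra.Build F U unit_scaleAr.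

Definition unit_inl (w : W) : U := (w, 0).
Definition unit_inr (a : A) : U := (0, a).

Lemma unit_mul_inl w w' : unit_inl w * unit_inl w' = unit_inl (w * w').
Proof.
rewrite /unit_inl unit_mulE /= (lin0 (lact_linear_r w)).
rewrite (lin0 (ract_linear_l w')).
by rewrite (lin0 (wmul_linear_l _)) !addr0.
Qed.

Lemma unit_mul_inlr w f : unit_inl w * unit_inr f = unit_inr (lact w f).
Proof.
rewrite /unit_inl /unit_inr unit_mulE /= mulr0 (lin0 (ract_linear_l 0)).
by rewrite (lin0 (wmul_linear_l _)) !addr0.
Qed.

Lemma unit_mul_inrl w f : unit_inr f * unit_inl w = unit_inr (ract f w).
Proof.
rewrite /unit_inl /unit_inr unit_mulE /= mul0r (lin0 (lact_linear_r 0)).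
by rewrite (lin0 (wmul_linear_r _)) add0r addr0.
Qed.

Lemma unit_mul_inr f g : unit_inr f * unit_inr g = unit_inr (wmul f g).
Proof.
rewrite /unit_inr unit_mulE /= mul0r (lin0 (lact_linear_l _)).
by rewrite (lin0 (ract_linear_r _)) !add0r.
Qed.

Lemma unit_inlB w w' : unit_inl w - unit_inl w' = unit_inl (w - w').
Proof. by congr pair; rewrite /= subr0. Qed.

Lemma unit_inrB f g : unit_inr f - unit_inr g = unit_inr (f - g).
Proof. by congr pair; rewrite /= subr0. Qed.

Lemma unit_commr_inl w w' :
  commr (unit_inl w) (unit_inl w') = unit_inl (commr w w').
Proof. by rewrite /commr !unit_mul_inl unit_inlB. Qed.

Lemma unit_commr_inlr w f :
  commr (unit_inl w) (unit_inr f) = unit_inr (lcomm w f).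
Proof. by rewrite /commr unit_mul_inlr unit_mul_inrl unit_inrB. Qed.

Lemma unit_commr_inrl w f :
  commr (unit_inr f) (unit_inl w) = unit_inr (rcomm f w).
Proof. by rewrite /commr unit_mul_inlr unit_mul_inrl unit_inrB. Qed.

Lemma unit_commr_inr f g :
  commr (unit_inr f) (unit_inr g) = unit_inr (wcomm f g).
Proof. by rewrite /commr !unit_mul_inr unit_inrB. Qed.

End Unitization.

(** * Letters modulo a T-ideal containing the generators *)

Lemma evalB (F : fieldType) (A : wAlgebra (grassmann F)) (a : nat -> A) f g :
  eval a (f - g) = eval a f - eval a g.
Proof. by have := eval_linear a (- 1) g f; rewrite !scaleN1r ![- _ + _]addrC. Qed.

Section LettersModTIdeal.
Context {F : fieldType}.
Variables (k : nat) (I : freeEX F -> Prop).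
Local Notation U := (unitization (freeEX F)).
Hypothesis tI : TW_ideal I.
Hypothesis genI : forall g, grassmannK_gen k g \/ E_trivial g -> I g.

Definition letter (l : nat) : U :=
  if (l < k)%N then unit_inl (gen l) else unit_inr (var (l - k)%N).

(** Requiring only theta_k w = 0 of the component w in E makes the generators of
    E beyond the first k congruent to 0 even when they multiply no variable. *)
Definition unit_ideal (b : U) : Prop := theta k b.1 = 0 /\ I b.2.

Let I_D f g : I f -> I g -> I (f + g).
Proof. by move=> If; rewrite -[f]scale1r; apply: TWD. Qed.
Let I_N f : I f -> I (- f).
Proof.
by move=> If; rewrite -scaleN1r -[_ *: _]addr0; apply: TWD => //; apply: TW0.
Qed.
Let I_Z c f : I f -> I (c *: f).
Proof. by move=> If; rewrite -[_ *: _]addr0; apply: TWD => //; apply: TW0. Qed.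

Let I_linext (K : choiceType) (f : K -> freeEX F) (m : {malg F[K]}) :
  (forall p, p \in msupp m -> I (f p)) -> I (linext f m).
Proof.
move=> If; rewrite linextE big_seq.
elim/big_ind: _ => [|a b|p /If]; [exact: TW0|exact: I_D|exact: I_Z].
Qed.

Let I_sub (a : nat -> freeEX F) g : I g -> I (eval a g).
Proof. by move=> Ig; apply: TWend (eval_whom a) _ Ig. Qed.

Lemma lact_large_gen j f : (k <= j)%N -> I (lact (gen j) f).
Proof.
move=> kj; have := I_sub (fun=> f) (genI (or_introl (gen_lact kj))).
by rewrite eval_lact eval_var.
Qed.

Lemma ract_large_gen j f : (k <= j)%N -> I (ract f (gen j)).
Proof.
move=> kj; have := I_sub (fun=> f) (genI (or_introl (gen_ract kj))).
by rewrite eval_ract eval_var.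
Qed.

Lemma gbase_remove (A : {fset nat}) j : j \in A ->
  exists c : F, gbase A = gen j * (c *: gbase (A `\ j)%fset) /\
     gbase A = ((-1) ^+ #|` A `\ j|%fset *: (c *: gbase (A `\ j)%fset)) * gen j.
Proof.
move=> jA; have dj : [disjoint [fset j] & A `\ j]%fset.
  by rewrite fdisjoint1X !inE eqxx.
have gE : gbase A = gen j * ((-1) ^+ inversions [fset j]%fset (A `\ j)%fset
    *: gbase (A `\ j)%fset) :> grassmann F.
  rewrite -scalerAr gmulE dj scalerA -expr2 sqrr_sign scale1r.
  by rewrite fsetD1K.
exists ((-1) ^+ inversions [fset j]%fset (A `\ j)%fset); split=> //.
rewrite {1}gE -scalerAr gen_gbase -!scalerAl.
by rewrite !scalerA mulrC.
Qed.

(** The kernel of theta_k is spanned by the basis elements with a factor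
    [gen j], k <= j, and such a factor annihilates E<X> modulo I on either
    side. *)
Lemma act_theta_ker w f : theta k w = 0 -> I (lact w f) /\ I (ract f w).
Proof.
move=> w0.
have wE : w = linext (fun A => gbase A - theta k (gbase A)) w.
  have lin : linear (fun u : grassmann F => u - theta k u).
    by move=> c u u'; rewrite linearP opprD addrACA scalerBr.
  by rewrite -(linear_linext _ _ lin) [linext _ w]linext_basis w0 subr0.
have lactE : lact w f = linext (fun A => lact (gbase A - theta k (gbase A)) f) w.
  by rewrite {1}wE (linear_linext _ _ (lact_linear_l f)).
have ractE : ract f w = linext (fun A => ract f (gbase A - theta k (gbase A))) w.
  by rewrite {1}wE (linear_linext _ _ (ract_linear_r f)).
have large A : gbase A - theta k (gbase A) = 0 :> grassmann F \/
    exists2 j, (k <= j)%N & j \in A /\ theta k (gbase A) = 0 :> grassmann F.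
  rewrite theta_base; case: ifP => [_|/negbT/fsubsetPn[j jA nj]].
    by left; rewrite subrr.
  by right; exists j => //; rewrite !inE mem_iota /= add0n -leqNgt in nj.
rewrite lactE ractE; split; apply: I_linext => A _.
  have [->|[j kj [jA ->]]] := large A.
    by rewrite (lin0 (lact_linear_l f)); apply: (TW0 tI).
  rewrite subr0; have [c [_ ->]] := gbase_remove jA; rewrite lactM.
  exact/(TWlact tI)/lact_large_gen.
have [->|[j kj [jA ->]]] := large A.
  by rewrite (lin0 (ract_linear_r f)); apply: (TW0 tI).
rewrite subr0; have [c [-> _]] := gbase_remove jA; rewrite ractM.
exact/(TWract tI)/ract_large_gen.
Qed.

Lemma unit_ideal_ideal : ideal_pred unit_ideal.
Proof.
split=> [|[w f] [u g] [/= w0 If] [/= u0 Ig]|[w f] [u g] [/= u0 Ig]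
  |[w f] [u g] [/= w0 If]].
- by split; [apply: linear0 | apply: (TW0 tI)].
- split; last exact: (I_D If Ig).
  by transitivity (theta k w + theta k u); [apply: linearD | rewrite w0 u0 addr0].
- split; rewrite /= ?thetaM ?u0 ?mulr0 //.
  apply: I_D; last exact: (TWmull tI).
  by apply: I_D; [apply: (TWlact tI) | have [] := act_theta_ker f u0].
- split; rewrite /= ?thetaM ?w0 ?mul0r //.
  apply: I_D; last exact: (TWmulr tI).
  by apply: I_D; [have [] := act_theta_ker g w0 | apply: (TWract tI)].
Qed.

Lemma unit_inr_ideal f : I f -> unit_ideal (unit_inr f).
Proof. by split=> //=; rewrite linear0. Qed.

Let uI := unit_ideal_ideal.
Let uIN b : unit_ideal b -> unit_ideal (- b).
Proof. by move=> /(ideal_predMl uI (- 1)); rewrite mulN1r. Qed.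

(** The generators of E and arbitrary elements of E<X>: contrary to the letters,
    these are closed under products with at least one factor in E<X>. *)
Inductive letter_like : U -> Prop :=
  | LetterLikeGen i : letter_like (unit_inl (gen i))
  | LetterLikeVar f : letter_like (unit_inr f).

Let I_wcommr f g : I f -> I (wcomm f g).
Proof. by move=> If; apply: I_D; [apply: (TWmulr tI)|apply/I_N/(TWmull tI)]. Qed.

Let comm3_var f g h : I (wcomm (wcomm f g) h).
Proof.
have := I_sub (fun i => if i == 0%N then f else if i == 1%N then g else h)
  (genI (or_introl (gen_comm3 k))).
by rewrite /wcomm !(evalB, eval_mul) !eval_var.
Qed.

Let comm3_gen_var i f g : I (wcomm (lcomm (gen i) f) g).
Proof.
have [ik|ki] := ltnP i k; last first.
  apply/I_wcommr/I_D; first exact: lact_large_gen.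
  exact/I_N/ract_large_gen.
have := I_sub (fun i => if i == 0%N then f else g)
  (genI (or_introl (gen_lcomm ik))).
by rewrite /wcomm /lcomm !(evalB, eval_mul, eval_lact, eval_ract) !eval_var.
Qed.

Let comm3_gen_var_gen i f j : I (rcomm (lcomm (gen i) f) (gen j)).
Proof.
have := I_sub (fun=> f) (genI (or_intror (E_trivial_gen i j))).
by rewrite /rcomm /lcomm !(evalB, eval_mul, eval_lact, eval_ract) !eval_var.
Qed.

Let comm_gen_gen f i j : I (rcomm f (gen i * gen j)).
Proof.
have := I_sub (fun=> f) (genI (or_intror (@E_trivial_even F [:: i; j] isT))).
rewrite /rcomm !(evalB, eval_lact, eval_ract) !eval_var.
by rewrite !big_cons big_nil mulr1.
Qed.

(** Up to antisymmetry there are five kinds of commutators.  Those of the forms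
    [x, x, x], [e, x, x] and [e, x, e] are substitution instances of the
    generating polynomials, except that [e_i, x, x] with i > k is obtained from
    e_i x and x e_i.  The commutator [e_i, e_j] = 2 e_i e_j is central by the
    trivial identities of even length, and [x, x, e] reduces to [x, e, x] by
    the Jacobi identity. *)
Lemma letter_like_central a b c : letter_like a -> letter_like b ->
  letter_like c -> unit_ideal (commr (commr a b) c).
Proof.
have efy i f y : letter_like y ->
    unit_ideal (commr (commr (unit_inl (gen i)) (unit_inr f)) y).
  case=> [j|g]; rewrite unit_commr_inlr.
    by rewrite unit_commr_inrl; apply: unit_inr_ideal.
  by rewrite unit_commr_inr; apply: unit_inr_ideal.
case=> [i|f] [j|g] ly; last first.
- case: ly => [l|h].
    rewrite commr_jacobi; apply: (ideal_predD uI).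
      by rewrite (commr_anti (unit_inr f)) commr_oppl; apply/uIN/efy; constructor.
    apply/uIN; rewrite (commr_anti (unit_inr g)) commr_oppl.
    by apply/uIN/efy; constructor.
  by rewrite !unit_commr_inr; apply: unit_inr_ideal.
- by rewrite (commr_anti (unit_inr f)) commr_oppl; apply/uIN/efy.
- exact: efy.
rewrite unit_commr_inl; case: ly => [l|f].
  by rewrite unit_commr_inl gcomm_central; apply: (ideal_pred0 uI).
rewrite unit_commr_inlr; apply: unit_inr_ideal.
have -> : commr (gen i) (gen j) = 2%:R *: (gen i * gen j) :> grassmann F.
  by rewrite /commr (gen_anticomm j i) opprK scaler_nat mulr2n.
have -> : lcomm (2%:R *: (gen i * gen j)) f =
    2%:R *: - rcomm f (gen i * gen j).
  rewrite /lcomm /rcomm (linZ (lact_linear_l f)) (linZ (ract_linear_r f)).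
  by rewrite -scalerBr opprB.
exact/I_Z/I_N/comm_gen_gen.
Qed.

(** The product bc is letter-like unless b and c are both generators of E, in
    which case it commutes with every letter-like element. *)
Lemma letter_like_product a b c d : letter_like a -> letter_like b ->
  letter_like c -> letter_like d -> unit_ideal (commr (commr a (b * c)) d).
Proof.
move=> la lb lc ld.
have llc b' : letter_like b' -> unit_ideal (commr (commr a b') d).
  by move=> lb'; apply: letter_like_central.
case: lb lc => [i|f] [j|g].
- rewrite unit_mul_inl.
  suff aI : unit_ideal (commr a (unit_inl (gen i * gen j))).
    rewrite [commr _ d]/commr; apply: (ideal_predD uI).
      exact: (ideal_predMr uI _ aI).
    by apply: uIN; apply: (ideal_predMl uI _ aI).
  case: la => [l|f]; last first.
    by rewrite unit_commr_inrl; apply/unit_inr_ideal/comm_gen_gen.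
  rewrite unit_commr_inl /commr.
  have := @gprod_central F [:: i; j] (gen l) isT.
  rewrite !big_cons big_nil mulr1 => ->; rewrite subrr.
  exact: (ideal_pred0 uI).
- by rewrite unit_mul_inlr; apply/llc; constructor.
- by rewrite unit_mul_inrl; apply/llc; constructor.
- by rewrite unit_mul_inr; apply/llc; constructor.
Qed.

(** This is [commr_product] together with the fact that the commutators of
    letter-like elements commute with each other. *)
Lemma letter_like_swap a b c d : letter_like a -> letter_like b ->
  letter_like c -> letter_like d ->
  eqmod unit_ideal (commr a b * commr c d) (- (commr a c * commr b d)).
Proof.
move=> la lb lc ld; rewrite /eqmod opprK.
have -> : commr a b * commr c d + commr a c * commr b d =
    commr a b * commr c d + commr b d * commr a c +
    commr (commr a c) (commr b d).
  by rewrite -addrA [commr b d * _ + _]addrC subrK.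
apply: (ideal_predD uI).
  rewrite commr_product; apply: (ideal_predD uI); last first.
    by apply/uIN/(ideal_predMl uI)/letter_like_central.
  apply: (ideal_predD uI); first exact: letter_like_product.
  by apply/uIN/(ideal_predMr uI)/letter_like_central.
have Xc y z : letter_like y -> letter_like z ->
    unit_ideal (commr (commr a c) (y * z)).
  move=> ly lz; rewrite commr_mulr; apply: (ideal_predD uI).
    by apply/(ideal_predMr uI)/letter_like_central.
  by apply/(ideal_predMl uI)/letter_like_central.
rewrite [commr b d]/commr commr_subr; apply: (ideal_predD uI); first exact: Xc.
exact/uIN/Xc.
Qed.

Lemma letter_likeP l : letter_like (letter l).
Proof. by rewrite /letter; case: ifP => _; constructor. Qed.

End LettersModTIdeal.

(** * Normal forms span the free algebra modulo the ideal *)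

Section WordSpan.
Context {F : fieldType}.
Variables (k : nat) (I : freeEX F -> Prop).
Local Notation U := (unitization (freeEX F)).
Hypothesis tI : TW_ideal I.
Hypothesis genI : forall g, grassmannK_gen k g \/ E_trivial g -> I g.
Hypothesis two_neq0 : 2%:R != 0 :> F.
Local Notation UI := (unit_ideal k I).
Local Notation span := (nf_span (I := UI) k (letter k)).

Let uI := unit_ideal_ideal tI genI.
Let lp := letter_likeP (F := F) k.

Lemma span_mull y s (b : U) : span s b ->
  span (filter (leq k) [:: y] ++ s) (letter k y * b).
Proof.
apply: nf_span_mull => // [a1 b1 c1|a1 b1 c1 d1|a1 b1 ak bk].
- rewrite /eqmod subr0; apply: (letter_like_central tI genI); exact: lp.
- apply: (letter_like_swap tI genI); exact: lp.
rewrite /letter ak bk !unit_mul_inl gen_anticomm /eqmod.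
rewrite (_ : unit_inl (- _) = - unit_inl (gen b1 * gen a1)).
  by rewrite subrr; apply: (ideal_pred0 uI).
by rewrite /unit_inl; congr pair; rewrite /= oppr0.
Qed.

Lemma span_gen i s (b : U) : span s b -> span s (unit_inl (gen i) * b).
Proof.
move=> sb; have [ik|ki] := ltnP i k.
  by have := span_mull i sb; rewrite /letter /= (leqNgt k i) ik.
apply: (nf_comb_eqmod uI (b' := 0)); last exact: (nf_comb0 uI).
rewrite /eqmod subr0; apply: (ideal_predMr uI); split; last exact: (TW0 tI).
by rewrite /= theta_gen ltnNge ki.
Qed.

Lemma span_var j s (b : U) : span s b ->
  span ((k + j)%N :: s) (unit_inr (var j) * b).
Proof.
by move/(span_mull (k + j)); rewrite /letter /= leq_addr ltnNge leq_addr /= addKn.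
Qed.

(** The basis elements of E are products of generators. *)
Lemma span_inl w s (b : U) : span s b -> span s (unit_inl w * b).
Proof.
move=> sb.
have lin : linear (fun x : grassmann F => unit_inl x * b : U).
  move=> c x y; rewrite (_ : unit_inl _ = c *: unit_inl x + unit_inl y).
    by rewrite mulrDl scalerAl.
  by rewrite /unit_inl; congr pair; rewrite /= scaler0 addr0.
have -> : unit_inl w * b = linext (fun A => unit_inl (gbase A) * b) w.
  by rewrite -(linear_linext gbase w lin) [linext _ w]linext_basis.
apply: (nf_comb_linext uI) => A _.
have sA : sorted ltn (sort leq A).
  rewrite ltn_sorted_uniq_leq sort_uniq fset_uniq /=.
  by apply: sort_sorted; apply: leq_total.
have -> : A = [fset i in sort leq A]%fset.
  by apply/fsetP => i; rewrite !inE mem_sort.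
rewrite -gen_prod //; move: (sort leq A) => l {A sA}.
elim: l => [|i l IHl]; first by rewrite big_nil mul1r.
rewrite big_cons -unit_mul_inl -mulrA; exact: span_gen.
Qed.

Lemma unit_inr_word1 w0 j wn :
  unit_inr (basis ((w0, j), [::], wn) : freeEX F) =
  unit_inl (gbase w0) * (unit_inr (var j) * (unit_inl (gbase wn) * 1)).
Proof.
rewrite mulr1 unit_mul_inrl unit_mul_inlr; congr unit_inr.
rewrite [ract _ _](free_ractU (gbase wn) _) word_ractE gbase0 mul1r linextU.
apply: esym; apply: etrans (free_lactU _ _) _.
by rewrite word_lactE gbase0 mulr1 linextU.
Qed.

Lemma unit_inr_wordS w0 j w1 j1 s wn :
  unit_inr (basis ((w0, j), (w1, j1) :: s, wn) : freeEX F) =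
  unit_inl (gbase w0) *
  (unit_inr (var j) * unit_inr (basis ((w1, j1), s, wn) : freeEX F)).
Proof.
rewrite unit_mul_inr unit_mul_inlr; congr unit_inr.
rewrite [wmul _ _](free_mulUU _ _) word_mulE gbase0 mul1r linextU.
apply: esym; apply: etrans (free_lactU _ _) _.
by rewrite word_lactE gbase0 mulr1 linextU.
Qed.

Lemma span_word u :
  span (map (addn k) (word_vars u)) (unit_inr (basis u : freeEX F)).
Proof.
case: u => [[[w0 j] s] wn]; elim: s w0 j => [|[w1 j1] s IHs] w0 j.
  rewrite unit_inr_word1; apply/span_inl/span_var/span_inl.
  exact: (nf_span1 uI).
by rewrite unit_inr_wordS; apply/span_inl/span_var/IHs.
Qed.

Lemma span_free (D : nf_index -> Prop) (f : freeEX F) :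
  (forall u, u \in msupp (f : {malg F[word]}) -> forall p,
     nf_valid k p -> perm_eq (nf_degree k p) (map (addn k) (word_vars u)) ->
     D p) ->
  nf_comb (I := UI) (letter k) D (unit_inr f).
Proof.
move=> fD.
have lin : linear (fun x : freeEX F => unit_inr x : U).
  by move=> c x y; rewrite /unit_inr; congr pair; rewrite /= scaler0 addr0.
have -> : unit_inr f = linext (fun u => unit_inr (basis u : freeEX F)) f.
  rewrite -(linear_linext (fun u => basis u : freeEX F) f lin).
  by rewrite [linext _ f]linext_basis.
apply: (nf_comb_linext uI) => u uf.
by apply: nf_comb_sub (span_word u) => p /andP[]; apply: fD.
Qed.
End WordSpan.

(** * Independence of the normal forms on E^(k) *)

Section Radix.
Variable M : nat.

(** The exponent of T in the monomial t_(s_1) t_(s_2) ... after the Kronecker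
    substitution t_l = T^(M^l); it turns polynomials in many variables into
    polynomials in one. *)
Definition radix_code (s : seq nat) : nat := (\sum_(l <- s) M ^ l)%N.

(** The multiplicity of j is the digit of index j of the code in base M: the
    letters below j contribute r and those above j contribute q.  The bound on
    r is multiplied by M to avoid the exponent j - 1. *)
Lemma radix_code_split j s : exists r q,
  radix_code s = (r + count_mem j s * M ^ j + q * M ^ j.+1)%N /\
  (r * M <= size s * M ^ j)%N.
Proof.
rewrite /radix_code; elim: s => [|l s [r [q [IHs rs]]]].
  by exists 0%N, 0%N; rewrite big_nil.
rewrite big_cons IHs /=; case: (ltngtP l j) => [lj|jl|->].
- exists (r + M ^ l)%N, q; split; first by rewrite add0n; lia.
  rewrite mulnDl mulSn addnC leq_add // -expnSr.
  case: M => [|M']; last by rewrite leq_pexp2l.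
  by rewrite exp0n.
- exists r, (q + M ^ (l - j.+1))%N; split; last first.
    by rewrite mulSn (leq_trans rs) ?leq_addl.
  by rewrite (mulnDl q) -expnD subnK // add0n; lia.
exists r, q; split; last by rewrite mulSn (leq_trans rs) ?leq_addl.
by rewrite (mulnDl 1%N) mul1n; lia.
Qed.

Lemma radix_code_digit j s : (size s < M)%N ->
  count_mem j s = ((radix_code s %/ M ^ j) %% M)%N.
Proof.
move=> sM; have [r [q [-> rs]]] := radix_code_split j s.
have M0 : (0 < M)%N by case: M sM.
have Mj : (0 < M ^ j)%N by rewrite expn_gt0 M0.
have rM : (r < M ^ j)%N.
  by rewrite -(ltn_pmul2r M0) (leq_ltn_trans rs) // mulnC ltn_pmul2l.
have -> : (r + count_mem j s * M ^ j + q * M ^ j.+1 =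
    (q * M + count_mem j s) * M ^ j + r)%N.
  by rewrite mulnDl expnS mulnA; lia.
rewrite divnMDl // divn_small // addn0 modnMDl modn_small //.
exact: leq_ltn_trans (count_size _ _) sM.
Qed.

Lemma radix_code_inj s t : (size s < M)%N -> (size t < M)%N ->
  radix_code s = radix_code t -> perm_eq s t.
Proof.
move=> sM tM st; apply/allP => j _ /=.
by rewrite !radix_code_digit // st.
Qed.
End Radix.

Section Independence.
Context {F : fieldType}.
Hypothesis char0 : [pchar F] =i pred0.
Local Notation E := (grassmann F).

Let natr_inj : injective (fun n : nat => n%:R : F).
Proof.
have n0 n : (n%:R == 0 :> F) = (n == 0%N) by move/pcharf0P: char0.
suff le m n : (m <= n)%N -> m%:R = n%:R :> F -> m = n.
  move=> m n mn; case/orP: (leq_total m n) => mn'; first exact: le.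
  exact/esym/le.
move=> mn /eqP; rewrite eq_sym -subr_eq0 -natrB // n0 subn_eq0 => nm.
by apply/eqP; rewrite eqn_leq mn.
Qed.

Lemma poly_eq0_char0 (q : {poly F}) : (forall n : nat, q.[n%:R] = 0) -> q = 0.
Proof.
move=> q0; apply/eqP; apply: contraT => nq0.
have := max_poly_roots nq0 (rs := [seq n%:R | n <- iota 0 (size q)]).
rewrite size_map size_iota ltnn; apply.
  by apply/allP => _ /mapP[n _ ->]; apply/rootP.
by rewrite map_inj_uniq ?iota_uniq.
Qed.

Variable k : nat.

Section Evaluation.
Variables (S : seq nat) (tau : nat -> F).

Definition odd_letter (l : nat) : E :=
  if (l < k)%N || (l \in S) then gen l else 0.

Definition letter_value (l : nat) : E :=
  (if (l < k)%N then 0 else (tau l)%:A) + odd_letter l.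

(** The scalar parts are central and the odd parts anticommute. *)
Lemma commr_letter_value a b : commr (letter_value a) (letter_value b) =
  2%:R *: (odd_letter a * odd_letter b).
Proof.
have sc l x : commr (if (l < k)%N then 0 else (tau l)%:A) x = 0 :> E.
  case: ifP => _; first by rewrite /commr mul0r mulr0 subrr.
  by rewrite /commr mulr_algl mulr_algr subrr.
rewrite /letter_value commr_addl sc add0r commr_addr commr_anti sc oppr0 add0r.
rewrite /odd_letter /commr.
case: ifP => _; last by rewrite mul0r mulr0 subrr scaler0.
case: ifP => _; last by rewrite mul0r mulr0 subrr scaler0.
by rewrite (gen_anticomm b a) opprK scaler_nat mulr2n.
Qed.

Lemma brackets_letter_value L : ~~ odd (size L) ->
  brackets (map letter_value L) =
  2%:R ^+ (size L)./2 *: \prod_(l <- L) odd_letter l.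
Proof.
elim/ltn_ind: {L}(size L) {-2}L (erefl (size L)) => n IH [|a [|b L]] //= sz eL.
  by rewrite big_nil scale1r.
rewrite commr_letter_value (IH (size L)) // -?sz //; last first.
  by rewrite /= negbK in eL.
by rewrite !big_cons -scalerAl -scalerAr scalerA -exprS !mulrA.
Qed.

Lemma alternator_letter_value L :
  (odd (size L) ==> (head k L < k)%N) ->
  alternator (map letter_value L) =
  2%:R ^+ (size L)./2 *: \prod_(l <- L) odd_letter l.
Proof.
rewrite /alternator; have [oL|eL] := boolP (odd (size L)) => /= hk.
  rewrite (brackets_odd (s := map _ L)) ?size_map // add0r.
  case: L oL hk => [//|h L] /= oL hk.
  rewrite brackets_letter_value // uphalf_half (negbTE oL) add0n big_cons.
  by rewrite /letter_value /odd_letter hk add0r scalerAr.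
rewrite brackets_letter_value //; case: L eL {hk} => [|h L] /= eL.
  by rewrite mul0r addr0.
by rewrite (brackets_odd (s := map _ L)) ?mulr0 ?addr0 ?size_map // -[odd _]negbK.
Qed.

Lemma normal_form_letter_value0 p : nf_valid k p ->
  ~~ all (mem S) (filter (leq k) p.2) -> normal_form letter_value p = 0.
Proof.
case: p => [a L] /and4P[/= _ _ _ hk] /allPn[l].
rewrite mem_filter => /andP[kl lL] /negbTE lS; have {}lS : l \in S = false by [].
rewrite /normal_form alternator_letter_value //=.
have -> : \prod_(l <- L) odd_letter l = 0 :> E.
  elim: L lL {hk} => //= h L IHL; rewrite inE big_cons => /orP[/eqP<-|/IHL->].
    by rewrite /odd_letter ltnNge kl /= lS mul0r.
  by rewrite mulr0.
by rewrite scaler0 mulr0.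
Qed.

(** The leading product contributes only its scalar part, because the odd part of
    each of its letters either is 0 or already divides the alternator. *)
Lemma normal_form_letter_value p : nf_valid k p ->
  filter (leq k) p.2 =i S ->
  normal_form letter_value p =
  ((\prod_(l <- p.1) tau l) * 2%:R ^+ (size p.2)./2) *:
    gbase [fset l in p.2]%fset.
Proof.
case: p => [a L] /and4P[/= _ ka sL hk] LS.
rewrite /normal_form alternator_letter_value //=.
have -> : \prod_(l <- L) odd_letter l = gbase [fset l in L]%fset :> E.
  rewrite -gen_prod //; apply: eq_big_seq => l lL.
  rewrite /odd_letter; have [//|kl /=] := ltnP l k.
  by rewrite -LS mem_filter kl lL.
rewrite -scalerAr mulrC -scalerA; congr (_ *: _).
elim: a ka => [|l a IHa] /= => [_|/andP[kl ka]].
  by rewrite !big_nil mul1r scale1r.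
rewrite !big_cons -mulrA IHa // -scalerAr /letter_value ltnNge kl /= mulrDl.
rewrite mulr_algl /odd_letter ltnNge kl /= -LS mem_filter kl /=.
have [lL|_] := boolP (l \in L).
  rewrite gmulE fdisjoint1X !inE lL /= addr0 scalerA mulrC //.
by rewrite mul0r addr0 scalerA mulrC.
Qed.
End Evaluation.

(** Choose a normal form p0 of the combination with the fewest variables in its
    alternator and let S be the set of these variables.  By minimality the
    normal forms that survive the evaluation have exactly S as bracket
    variables; those with the alternator of p0 are the ones contributing to
    the basis vector of p0.  This coefficient is a polynomial in the parameter
    T of the Kronecker substitution that vanishes on all natural numbers, and
    its exponents separate the leading products. *)
Theorem nf_independent (m : {malg F[nf_index]}) :
  (forall p, p \in msupp m -> nf_valid k p) ->
  (forall w : nat -> E, (forall l, (l < k)%N -> w l = gen l) ->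
     linext (normal_form w) m = 0) ->
  m = 0.
Proof.
move=> m_valid m_eval; apply/eqP; apply: contraT => m_neq0.
pose xs (p : nf_index) := filter (leq k) p.2.
have exm : exists n, has (fun p => size (xs p) == n) (msupp m).
  have [p pm] := msupp_ex m_neq0.
  by exists (size (xs p)); apply/hasP; exists p.
case: (ex_minnP exm) => n0 /hasP[p0 p0m /eqP p0n] minm.
pose M := (\max_(p <- msupp m) size p.1).+1.
have ltM p : p \in msupp m -> (size p.1 < M)%N.
  by move=> pm; rewrite ltnS (leq_bigmax_seq (F := fun p => size p.1)).
pose q : {poly F} :=
  \sum_(p <- msupp m | p.2 == p0.2) m@_p *: 'X^(radix_code M p.1).
have two0 : 2%:R != 0 :> F by move/pcharf0P: char0 => ->.
have q0 : q = 0.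
  apply: poly_eq0_char0 => n.
  pose w := letter_value (xs p0) (fun l => n%:R ^+ (M ^ l)).
  have wg l : (l < k)%N -> w l = gen l.
    by move=> lk; rewrite /w /letter_value /odd_letter lk add0r.
  pose K := [fset l in p0.2]%fset.
  have termE p : p \in msupp m ->
      m@_p * mcoeff K (normal_form w p) = if p.2 == p0.2 then
        (m@_p *: 'X^(radix_code M p.1)).[n%:R] * 2%:R ^+ (size p0.2)./2 else 0.
    move=> pm; have vp := m_valid p pm; have vp0 := m_valid p0 p0m.
    have sp : sorted ltn p.2 by case/and4P: vp.
    have sp0 : sorted ltn p0.2 by case/and4P: vp0.
    have [sub|nsub] := boolP (all (mem (xs p0)) (xs p)); last first.
      rewrite normal_form_letter_value0 // mcoeff0 mulr0; case: eqP => // pp0.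
      by case/negP: nsub; apply/allP => l; rewrite /xs pp0.
    have [_ xsE] : (size (xs p) = size (xs p0)) * (xs p =i xs p0).
      apply: uniq_min_size; last by rewrite p0n minm //; apply/hasP; exists p.
        by apply/filter_uniq/(sorted_uniq ltn_trans ltnn).
      exact/allP.
    rewrite normal_form_letter_value // mcoeffZ /gbase basisE mcoeffU.
    have -> : ([fset l in p.2]%fset == K) = (p.2 == p0.2).
      apply/eqP/eqP => [/fsetP pK|->//].
      apply: (irr_sorted_eq ltn_trans ltnn) => // l.
      by have := pK l; rewrite !inE.
    case: eqP => [pp0|_]; last by rewrite !mulr0.
    by rewrite hornerZ hornerXn pp0 mulr1 mulrA prodrXr.
  have := congr1 (mcoeff K) (m_eval w wg).
  rewrite linextE mcoeff0 raddf_sum /= big_seq.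
  under eq_bigr => p pm do rewrite mcoeffZ termE //.
  rewrite -big_seq -big_mkcond -mulr_suml -horner_sum => /eqP.
  by rewrite mulf_eq0 expf_eq0 (negbTE two0) andbF orbF => /eqP.
have := congr1 (fun r : {poly F} => r`_(radix_code M p0.1)) q0.
rewrite coef0 coef_sum big_mkcond (bigD1_seq p0) ?fset_uniq //= eqxx.
rewrite big1_seq => [|p /andP[np0 pm]]; last first.
  case: eqP => // pp0; rewrite coefZ coefXn.
  case: eqP => [rE|_]; last by rewrite mulr0.
  case/eqP: np0; have pe := radix_code_inj (ltM _ p0m) (ltM _ pm) rE.
  have/and4P[sp _ _ _] := m_valid p pm; have/and4P[sp0 _ _ _] := m_valid p0 p0m.
  have := sorted_eq leq_trans anti_leq sp0 sp pe.
  by case: (p) (p0) pp0 => [a L] [a0 L0] /= -> ->.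
rewrite coefZ coefXn eqxx mulr1 addr0 => /eqP.
by rewrite -[_ == 0]negbK mcoeff_neq0 p0m.
Qed.
End Independence.

(** * The identities of E^(k) *)

Section SpanIdeal.
Context {F : fieldType} {W : algType F} {A : wAlgebra W}.

Lemma TW_span_ideal (S : A -> Prop) : TW_ideal (TW_span S).
Proof.
split.
- by move=> I tI _; apply: (TW0 tI).
- by move=> c f g sf sg I tI SI; apply: (TWD tI); [apply: sf|apply: sg].
- by move=> f g sg I tI SI; apply: (TWmull tI); apply: sg.
- by move=> f g sf I tI SI; apply: (TWmulr tI); apply: sf.
- by move=> w f sf I tI SI; apply: (TWlact tI); apply: sf.
- by move=> f w sf I tI SI; apply: (TWract tI); apply: sf.
by move=> phi wphi f sf I tI SI; apply: (TWend tI wphi); apply: sf.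
Qed.

Lemma TW_span_gen (S : A -> Prop) g : S g -> TW_span S g.
Proof. by move=> Sg I _; apply. Qed.
End SpanIdeal.

Section Identities.
Context {F : fieldType}.

Lemma IdE_ideal (A : wAlgebra (grassmann F)) : TW_ideal (IdE A).
Proof.
split.
- by move=> a; apply: (lin0 (eval_linear a)).
- move=> c f g If Ig a; rewrite (eval_linear a) If Ig scaler0 addr0 //.
- by move=> f g Ig a; rewrite eval_mul Ig (lin0 (wmul_linear_r _)).
- by move=> f g If a; rewrite eval_mul If (lin0 (wmul_linear_l _)).
- by move=> w f If a; rewrite eval_lact If (lin0 (lact_linear_r _)).
- by move=> f w If a; rewrite eval_ract If (lin0 (ract_linear_l _)).
move=> phi [pl pm pL pR] f If a.
have wh : whom (fun x => eval a (phi x)).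
  split=> [|x y|w x|x w].
  - exact: linear_comp (eval_linear a) pl.
  - by rewrite pm eval_mul.
  - by rewrite pL eval_lact.
  - by rewrite pR eval_ract.
by rewrite (eval_unique wh).
Qed.

(** E acts on E^(k) by multiplication in E, so each generator evaluates to a
    triple commutator, to a commutator with an even product, or to a multiple
    of some theta_k(e_j) = 0. *)
Lemma generators_IdE k (g : freeEX F) :
  grassmannK_gen k g \/ E_trivial g -> IdE (grassmannK k) g.
Proof.
have theta_large j : (k <= j)%N -> theta k (gen j) = 0 :> grassmann F.
  by move=> kj; rewrite theta_gen ltnNge kj.
case=> [[|i ik|j kj|j kj]|[s es|i j]] a.
- by rewrite /wcomm !(evalB, eval_mul); apply: gcomm_central.
- rewrite /wcomm /lcomm !(evalB, eval_mul, eval_lact, eval_ract).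
  exact: gcomm_central.
- rewrite eval_lact; rewrite /= /grassmannK_lact theta_large // mul0r //.
- rewrite eval_ract; rewrite /= /grassmannK_ract theta_large // mulr0 //.
- rewrite /rcomm evalB eval_ract eval_lact /= /grassmannK_ract /grassmannK_lact.
  rewrite rmorph_prod /=.
  have [/allP sk|/allPn[j js jk]] := boolP (all (fun j => j < k)%N s).
    rewrite (eq_big_seq gen) => [|j /sk jk]; last by rewrite theta_gen jk.
    by rewrite gprod_central // subrr.
  rewrite (_ : \prod_(i <- s) theta k (gen i) = 0) ?mul0r ?mulr0 ?subrr //.
  elim: s js {es} => //= h s IHs; rewrite inE big_cons => /orP[/eqP<-|/IHs->].
    by rewrite theta_large ?mul0r // leqNgt.
  by rewrite mulr0.
rewrite /rcomm /lcomm !(evalB, eval_lact, eval_ract).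
exact: gcomm_central.
Qed.
End Identities.

Section UnitEvaluation.
Context {F : fieldType}.
Variables (k : nat) (a : nat -> grassmann F).
Local Notation U := (unitization (freeEX F)).
Let ev (f : freeEX F) : grassmann F := eval (a : nat -> grassmannK k) f.

(** A homomorphism of unital algebras extending the evaluation at a; it carries
    normal forms in the free algebra to normal forms in E. *)
Definition unit_eval (b : U) : grassmann F := theta k b.1 + ev b.2.

Lemma unit_eval_linear : linear unit_eval.
Proof.
move=> c [w f] [u g]; rewrite /unit_eval /=.
have -> : theta k (c *: w + u) = c *: theta k w + theta k u.
  exact: theta_linear.
by rewrite [ev _](eval_linear (a : nat -> grassmannK k) c f g) scalerDr addrACA.
Qed.

Lemma unit_evalM : {morph unit_eval : x y / x * y}.
Proof.
move=> [w f] [u g]; rewrite /unit_eval unit_mulE /=.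
have evD x y : ev (x + y) = ev x + ev y.
  by have := eval_linear (a : nat -> grassmannK k) 1 x y; rewrite !scale1r.
rewrite !evD [ev (wmul _ _)](eval_mul (a : nat -> grassmannK k)).
rewrite [ev (lact _ _)](eval_lact (a : nat -> grassmannK k)).
rewrite [ev (ract _ _)](eval_ract (a : nat -> grassmannK k)).
by rewrite thetaM mulrDl !mulrDr !addrA.
Qed.

Lemma unit_eval1 : unit_eval 1 = 1.
Proof.
rewrite /unit_eval /= theta1.
by rewrite [ev 0](lin0 (eval_linear (a : nat -> grassmannK k))) addr0.
Qed.

Lemma unit_eval_inr f : unit_eval (unit_inr f) = ev f.
Proof. by rewrite /unit_eval /= linear0 add0r. Qed.

Lemma unit_eval_letter l :
  unit_eval (letter k l) = if (l < k)%N then gen l else a (l - k)%N.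
Proof.
rewrite /letter; case: ifP => lk.
  rewrite /unit_eval /= theta_gen lk.
  by rewrite [ev 0](lin0 (eval_linear (a : nat -> grassmannK k))) addr0.
by rewrite unit_eval_inr /ev eval_var.
Qed.

Lemma unit_eval_normal_form p : unit_eval (normal_form (letter k) p) =
  normal_form (fun l => unit_eval (letter k l)) p.
Proof.
have ev0 : unit_eval 0 = 0 by exact: lin0 unit_eval_linear.
have evB x y : unit_eval (x - y) = unit_eval x - unit_eval y.
  by have := unit_eval_linear (- 1) y x; rewrite !scaleN1r ![- _ + _]addrC.
have evD x y : unit_eval (x + y) = unit_eval x + unit_eval y.
  by have := unit_eval_linear 1 x y; rewrite !scale1r.
have brE L : unit_eval (brackets (map (letter k) L)) =
    brackets (map (fun l => unit_eval (letter k l)) L).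
  elim/ltn_ind: {L}(size L) {-2}L (erefl (size L)) => n IH [|x [|y L]] //= sz.
    exact: unit_eval1.
  by rewrite unit_evalM evB !unit_evalM (IH (size L)) // -sz.
rewrite /normal_form unit_evalM /alternator evD unit_evalM brE.
congr (_ * (_ + _)).
  elim: p.1 => [|l s IHs]; first by rewrite !big_nil unit_eval1.
  by rewrite !big_cons unit_evalM IHs.
case: p.2 => [|l L] /=; first by rewrite ev0 !mul0r.
by rewrite brE.
Qed.
End UnitEvaluation.

Section Basis.
Context {F : fieldType}.
Variable k : nat.
Hypothesis char0 : [pchar F] =i pred0.
Local Notation U := (unitization (freeEX F)).
Local Notation gens := (fun g : freeEX F => grassmannK_gen k g \/ E_trivial g).
Local Notation TI := (TW_span gens).

Let two_neq0 : 2%:R != 0 :> F.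
Proof. by move/pcharf0P: char0 => ->. Qed.

Lemma TW_span_IdE f : TI f -> IdE (grassmannK k) f.
Proof. by apply; [apply: IdE_ideal | apply: generators_IdE]. Qed.

Lemma unit_eval_ideal a (b : U) : unit_ideal k TI b -> unit_eval k a b = 0.
Proof. by case=> b1 b2; rewrite /unit_eval b1 (TW_span_IdE b2) addr0. Qed.

Lemma unit_eval_comb a (m : {malg F[nf_index]}) :
  unit_eval k a (linext (normal_form (letter k)) m) =
  linext (normal_form (fun l => unit_eval k a (letter k l))) m.
Proof.
rewrite (linear_linext _ _ (@unit_eval_linear F k a)).
by apply: eq_linext => p; rewrite unit_eval_normal_form.
Qed.

(** Evaluating the variables at arbitrary elements of E^(k) realizes all the
    substitutions considered in [nf_independent]. *)
Lemma comb_independent (m : {malg F[nf_index]}) :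
  (forall p, p \in msupp m -> nf_valid k p) ->
  (forall a, unit_eval k a (linext (normal_form (letter k)) m) = 0) -> m = 0.
Proof.
move=> mv m0; apply: (nf_independent char0 mv) => w wg.
rewrite -(m0 (fun j => w (k + j)%N)) unit_eval_comb; apply: eq_linext => p.
rewrite /normal_form; congr (_ * alternator _).
  apply: eq_bigr => l _; rewrite unit_eval_letter; case: ltnP => [/wg//|kl].
  by rewrite subnKC.
apply: eq_map => l; rewrite unit_eval_letter; case: ltnP => [/wg//|kl].
by rewrite subnKC.
Qed.

Lemma free_normal_comb (D : nf_index -> Prop) (f : freeEX F) :
  (forall u, u \in msupp (f : {malg F[word]}) -> forall p, nf_valid k p ->
     perm_eq (nf_degree k p) (map (addn k) (word_vars u)) -> D p) ->
  exists2 m : {malg F[nf_index]}, forall p, p \in msupp m -> D p &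
    unit_ideal k TI (unit_inr f - linext (normal_form (letter k)) m).
Proof.
exact: (span_free (TW_span_ideal _) (@TW_span_gen _ _ _ _) two_neq0).
Qed.

(** The normal form of an identity modulo the generated ideal is again an
    identity, hence it is zero. *)
Theorem IdE_generated f : IdE (grassmannK k) f <-> TI f.
Proof.
split=> [f0|]; last exact: TW_span_IdE.
have [m mv fm] := @free_normal_comb (nf_valid k) f (fun _ _ _ vp _ => vp).
suff m0 : m = 0 by have [] := fm; rewrite m0 linear0 subr0.
apply: comb_independent => // a; have := unit_eval_ideal a fm.
have -> : unit_inr f - linext (normal_form (letter k)) m =
    (- 1) *: linext (normal_form (letter k)) m + unit_inr f.
  by rewrite scaleN1r addrC.
rewrite unit_eval_linear unit_eval_inr f0 addr0 scaleN1r => /eqP.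
by rewrite oppr_eq0 => /eqP.
Qed.
End Basis.

(** * Multidegrees of normal forms *)

Section Homogeneous.
Context {F : fieldType}.
Local Notation FX := {malg F[word]}.
Local Notation U := (unitization (freeEX F)).

Definition supported (D : word -> Prop) (f : FX) : Prop :=
  forall u, u \in msupp f -> D u.

Lemma supportedZD D c f g :
  supported D f -> supported D g -> supported D (c *: f + g).
Proof.
move=> fD gD u /(fsubsetP (msuppD_le _ _)); rewrite in_fsetU => /orP[|/gD//].
by move/(fsubsetP (msuppZ_le _ _))/fD.
Qed.

Lemma supported0 D : supported D 0.
Proof. by move=> u; rewrite msupp0 inE. Qed.

Lemma supported_basis (D : word -> Prop) u : D u -> supported D (basis u).
Proof. by move=> Du v; rewrite basisE msuppU oner_eq0 inE => /eqP->. Qed.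

Lemma supported_linext D (K : choiceType) (f : K -> FX) (m : {malg F[K]}) :
  (forall p, p \in msupp m -> supported D (f p)) -> supported D (linext f m).
Proof.
move=> sf; rewrite linextE big_seq.
elim/big_ind: _ => [|a b aD bD|p /sf pD]; first exact: supported0.
  by rewrite -[a]scale1r; apply: supportedZD.
by rewrite -[_ *: _]addr0; apply: supportedZD => //; apply: supported0.
Qed.

(** Multihomogeneity in the unitization, where the component in E has
    multidegree [::]. *)
Definition homogeneous (s : seq nat) (b : U) : Prop :=
  (s != [::] -> b.1 = 0) /\ supported (fun u => perm_eq (word_vars u) s) b.2.

Lemma homogeneousZD s c a b :
  homogeneous s a -> homogeneous s b -> homogeneous s (c *: a + b).
Proof.
move=> [a1 a2] [b1 b2]; split; last exact: supportedZD.
move=> sn; rewrite -[LHS]/(c *: a.1 + b.1) a1 // b1 // scaler0 addr0 //.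
Qed.

Lemma homogeneous0 s : homogeneous s 0.
Proof. by split=> //; apply: supported0. Qed.

Lemma homogeneousB s a b :
  homogeneous s a -> homogeneous s b -> homogeneous s (a - b).
Proof. by move=> ha hb; rewrite addrC -scaleN1r; apply: homogeneousZD. Qed.

Lemma homogeneous_perm s t b : perm_eq s t -> homogeneous s b -> homogeneous t b.
Proof.
move=> st [b1 b2]; split=> [tn|u /b2 us]; last exact: perm_trans us st.
apply: b1; apply: contraNneq tn => s0.
by move: st; rewrite s0 perm_sym => /perm_nilP->.
Qed.

Lemma homogeneous1 : homogeneous [::] 1.
Proof. by split=> //; apply: supported0. Qed.

(** When one factor has multidegree [::] its component in E<X> is 0, every word
    containing a variable; otherwise its component in E is 0.  So each of the
    three terms of the second component of the product either vanishes or has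
    multidegree s ++ t. *)
Lemma homogeneousM s t a b :
  homogeneous s a -> homogeneous t b -> homogeneous (s ++ t) (a * b).
Proof.
case: a b => [w f] [w' g] [/= w0 fs] [/= w'0 gt].
split.
  case: s w0 {fs} => [_|x s /(_ isT) -> _]; last by rewrite unit_mulE /= mul0r.
  by move=> /w'0 t0; rewrite unit_mulE /= t0 mulr0.
have fnil (h : FX) : supported (fun u => perm_eq (word_vars u) [::]) h -> h = 0.
  move=> h0; apply/eqP; apply: contraT => hn.
  by have [u /h0/perm_nilP] := msupp_ex hn.
have sD (x y : FX) D : supported D x -> supported D y -> supported D (x + y).
  by move=> xD; rewrite -[x]scale1r; apply: supportedZD.
rewrite unit_mulE; apply: (sD); first apply: (sD).
- have [->|sn] := eqVneq s [::]; last first.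
    by rewrite /= w0 // (lin0 (free_lact_ll _)); apply: supported0.
  apply: supported_linext => -[[[v j] l] v'] /gt /= ut.
  by apply: supported_linext => C _; apply: supported_basis.
- have [->|tn] := eqVneq t [::]; last first.
    by rewrite /= w'0 // (lin0 (free_ract_lr _)); apply: supported0.
  rewrite cats0; apply: supported_linext => -[[[v j] l] v'] /fs /= us.
  by apply: supported_linext => C _; apply: supported_basis.
apply: supported_linext => u /fs us; apply: supported_linext => v /gt vt.
case: u v us vt => [[[u0 i] l] u1] [[[v0 j] l'] v1] /= us vt.
apply: supported_linext => C _; apply: supported_basis.
rewrite /word_vars /= map_cat /= -[i :: map snd l ++ _]/((i :: map snd l) ++ _).
exact: perm_cat.
Qed.
End Homogeneous.

Section HomogeneousNF.
Context {F : fieldType}.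
Variable k : nat.
Local Notation U := (unitization (freeEX F)).

Definition letter_vars (s : seq nat) : seq nat :=
  [seq (l - k)%N | l <- s & (k <= l)%N].

Lemma letter_vars_cat s t : letter_vars (s ++ t) = letter_vars s ++ letter_vars t.
Proof. by rewrite /letter_vars filter_cat map_cat. Qed.

Lemma homogeneous_letter l : homogeneous (letter_vars [:: l]) (letter k l : U).
Proof.
rewrite /letter /letter_vars /= ltnNge; case: leqP => /= kl.
  by split=> //=; apply: supported_basis.
by split=> //; apply: supported0.
Qed.

Lemma homogeneous_prod s :
  homogeneous (letter_vars s) (\prod_(l <- s) (letter k l : U)).
Proof.
elim: s => [|l s IHs]; first by rewrite big_nil; apply: homogeneous1.
rewrite big_cons -cat1s letter_vars_cat.
exact: homogeneousM (homogeneous_letter l) IHs.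
Qed.

Lemma homogeneous_brackets s :
  homogeneous (letter_vars s) (brackets (map (letter k) s) : U).
Proof.
elim/ltn_ind: {s}(size s) {-2}s (erefl (size s)) => n IH [|a [|b s]] sz.
- exact: homogeneous1.
- exact: homogeneous0.
rewrite -(cat1s a) -(cat1s b) catA !letter_vars_cat.
apply: homogeneousM; last by apply: (IH (size s)); rewrite // -sz.
apply: homogeneousB; first by apply: homogeneousM; apply: homogeneous_letter.
apply: (homogeneous_perm (s := letter_vars [:: b] ++ letter_vars [:: a])).
  by rewrite perm_catC.
by apply: homogeneousM; apply: homogeneous_letter.
Qed.

Lemma homogeneous_normal_form p :
  homogeneous (letter_vars (p.1 ++ p.2)) (normal_form (letter k) p : U).
Proof.
rewrite letter_vars_cat; apply: homogeneousM; first exact: homogeneous_prod.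
rewrite /alternator -[_ + _]scale1r scalerDr.
apply: homogeneousZD; first exact: homogeneous_brackets.
rewrite scale1r; case: p.2 => [|l s] /=.
  by rewrite mul0r; apply: homogeneous0.
rewrite -cat1s letter_vars_cat.
exact: homogeneousM (homogeneous_letter l) (homogeneous_brackets s).
Qed.

Lemma letter_vars_degree p : nf_valid k p ->
  letter_vars (p.1 ++ p.2) = [seq (l - k)%N | l <- nf_degree k p].
Proof.
case/and4P => _ /all_filterP ka _ _.
by rewrite /letter_vars /nf_degree filter_cat ka.
Qed.

End HomogeneousNF.

(** * The multilinear normal forms and their number *)

(** In a multilinear normal form each variable occurs once, either in the
    alternator or in the leading product, so the letters T of the alternator
    determine the rest. *)
Section MultilinearIndices.
Variables k n : nat.
Implicit Type T : {set 'I_(k + n)}.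

Definition index_good T : bool :=
  ~~ odd #|T| || [exists i in T, (i < k)%N].

Definition index_letters T : seq nat := [seq val i | i <- enum T].

Definition index_nf T : nf_index :=
  ([seq l <- iota k n | l \notin index_letters T], index_letters T).

Lemma mem_index_letters T (i : 'I_(k + n)) :
  (val i \in index_letters T) = (i \in T).
Proof. by rewrite mem_map ?mem_enum //; apply: val_inj. Qed.

Lemma index_letters_bound T l : l \in index_letters T -> (l < k + n)%N.
Proof. by case/mapP => i _ ->; apply: ltn_ord. Qed.

Lemma index_letters_sorted T : sorted ltn (index_letters T).
Proof.
apply: (subseq_sorted ltn_trans _ (iota_ltn_sorted 0 (k + n))).
by rewrite -val_enum_ord; apply/map_subseq; rewrite enumT; apply: filter_subseq.
Qed.

Lemma index_nf_inj : injective index_nf.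
Proof.
move=> T T' [_ TT]; apply/setP => i.
by rewrite -!mem_index_letters TT.
Qed.

Lemma index_nf_valid T : index_good T -> nf_valid k (index_nf T).
Proof.
move=> gT; apply/and4P; split=> /=.
- by apply: sorted_filter; [apply: leq_trans | apply: iota_sorted].
- by apply/allP => l; rewrite mem_filter mem_iota => /and3P[].
- exact: index_letters_sorted.
apply/implyP; rewrite size_map -cardE => oT.
move: gT; rewrite /index_good oT /= => /existsP[i /andP[iT ik]].
move: iT (index_letters_sorted T); rewrite -mem_index_letters.
case: (index_letters T) => //= h L; rewrite inE => /orP[/eqP<- //|iL].
by move/(order_path_min ltn_trans)/allP/(_ _ iL) => hi; apply: ltn_trans hi ik.
Qed.

Lemma index_nf_degree T : perm_eq (nf_degree k (index_nf T)) (iota k n).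
Proof.
apply: uniq_perm; last 2 first.
- exact: iota_uniq.
- move=> l; rewrite mem_cat !mem_filter mem_iota.
  have := @index_letters_bound T l; case: (l \in _) => /= [/(_ isT) lb|_].
    by rewrite andbT lb andbT.
  by rewrite andbF orbF.
rewrite cat_uniq !filter_uniq ?iota_uniq //=; last first.
  exact: (sorted_uniq ltn_trans ltnn (index_letters_sorted T)).
rewrite andbT; apply/hasPn => l; rewrite !mem_filter => /andP[_ ->] //.
Qed.

Lemma index_nf_surj p : nf_valid k p -> perm_eq (nf_degree k p) (iota k n) ->
  exists2 T, index_good T & p = index_nf T.
Proof.
case: p => [a L] /and4P[/= sa ka sL hk]; rewrite /nf_degree /= => dp.
pose T := [set i : 'I_(k + n) | val i \in L].
have Lb l : l \in L -> (l < k + n)%N.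
  move=> lL; have [lk|kl] := ltnP l k; first exact: ltn_addr.
  have := perm_mem dp l; rewrite mem_cat mem_filter kl lL orbT mem_iota.
  by move=> /esym/andP[].
have LE : index_letters T = L.
  apply: (irr_sorted_eq ltn_trans ltnn) => //; first exact: index_letters_sorted.
  move=> l; apply/idP/idP => [|lL].
    by case/mapP => i; rewrite mem_enum inE => iL ->.
  by rewrite -[l]/(val (Ordinal (Lb l lL))) mem_index_letters inE.
exists T; last first.
  rewrite /index_nf LE; congr pair.
  have ud : uniq (a ++ filter (leq k) L) by rewrite (perm_uniq dp) iota_uniq.
  have ua : uniq a by move: ud; rewrite cat_uniq => /andP[].
  apply: (sorted_eq leq_trans anti_leq) => //.
    by apply: sorted_filter; [apply: leq_trans | apply: iota_sorted].
  apply: uniq_perm => //; first by rewrite filter_uniq // iota_uniq.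
  move=> l; rewrite mem_filter -(perm_mem dp) mem_cat mem_filter.
  have [la|nla] := boolP (l \in a) => /=; last by case: (l \in L); rewrite ?andbF.
  rewrite andbT; apply/esym/negP => lL; move: ud; rewrite cat_uniq.
  case/and3P => _ /hasPn/(_ l) + _; rewrite mem_filter lL andbT la.
  by move/(allP ka): la => -> /(_ isT).
rewrite /index_good cardE -(size_map val) -/(index_letters T) LE.
case: (odd _) hk => //= hk; apply/existsP.
have hL : head k L \in L by case: (L) hk => [|h L'] /=; rewrite ?ltnn // mem_head.
by exists (Ordinal (Lb _ hL)); rewrite inE /= hL.
Qed.

End MultilinearIndices.

(** Removing x is a bijection from the odd subsets of A to all subsets of A
    without x; the parity tells whether x must be put back. *)
Lemma card_odd_subsets (T : finType) (A : {set T}) x : x \in A ->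
  #|[set B in powerset A | odd #|B|]| = (2 ^ #|A|.-1)%N.
Proof.
move=> xA; pose f (B : {set T}) := if odd #|B| then B else x |: B.
have -> : [set B in powerset A | odd #|B|] = f @: powerset (A :\ x).
  apply/setP => B; rewrite !inE; apply/andP/imsetP => [[BA oB]|[C]]; last first.
    rewrite inE subsetD1 => /andP[CA xC] ->; rewrite /f; case: ifP => // oC.
    by rewrite subUset sub1set xA CA cardsU1 xC /= oC.
  have [xB|xB] := boolP (x \in B); last first.
    by exists B; rewrite ?inE ?subsetD1 ?BA // /f oB.
  exists (B :\ x); first by rewrite inE setSD.
  by move: oB; rewrite (cardsD1 x B) xB /= /f => /negbTE ->; rewrite setD1K.
rewrite card_in_imset ?card_powerset ?(cardsD1 x A) ?xA // => B C.
rewrite !inE !subsetD1 => /andP[_ xB] /andP[_ xC] fBC.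
have fK (D : {set T}) : x \notin D -> f D :\ x = D.
  move=> xD; apply/setP => y; rewrite /f !inE.
  by case: ifP; rewrite ?inE; case: eqVneq => //= ->; rewrite (negbTE xD).
by rewrite -(fK B xB) -(fK C xC) fBC.
Qed.

(** The excluded sets are the odd sets of variables. *)
Lemma card_index_good k n : (0 < n)%N ->
  #|[set T : {set 'I_(k + n)} | index_good T]| =
  (2 ^ n.-1 * (2 ^ k.+1 - 1))%N.
Proof.
move=> n0; pose H := [set i : 'I_(k + n) | k <= i]%N.
have cH : #|H| = n.
  have -> : H = @rshift k n @: setT.
    apply/setP => i; rewrite inE; apply/idP/imsetP => [ki|[j _ ->]]; last first.
      by rewrite /= leq_addr.
    have ij : (i - k < n)%N by rewrite ltn_subLR.
    by exists (Ordinal ij) => //; apply: val_inj; rewrite /= subnKC.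
  by rewrite card_imset ?cardsT ?card_ord //; apply: rshift_inj.
have -> : [set T : {set 'I_(k + n)} | index_good T] =
    ~: [set T in powerset H | odd #|T|].
  apply/setP => T; rewrite !inE /index_good negb_and orbC; congr (_ || _).
  apply/existsP/subsetPn => [[i /andP[iT ik]]|[i iT]].
    by exists i; rewrite // inE -ltnNge.
  by rewrite inE -ltnNge => ik; exists i; rewrite iT.
have ki0 : (k + 0 < k + n)%N by rewrite ltn_add2l.
have x0H : Ordinal ki0 \in H by rewrite inE /= addn0.
have := cardsC [set T in powerset H | odd #|T|].
rewrite (card_odd_subsets x0H) cH -cardsT -powersetT card_powerset cardsT.
rewrite card_ord.
move=> cE; rewrite mulnBr muln1 -expnD.
have -> : (n.-1 + k.+1 = k + n)%N by lia.
by rewrite -cE addKn.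
Qed.

Lemma word_vars_shift (k n : nat) (s : seq nat) :
  perm_eq s (iota 0 n) -> perm_eq (map (addn k) s) (iota k n).
Proof. by move/(perm_map (addn k)); rewrite -iotaDl addn0. Qed.

(** The basis consists of the normal forms indexed by the good sets: they span by
    [free_normal_comb], which respects multidegrees, and are independent by
    [comb_independent]. *)
Lemma codimension_grassmannK (F : fieldType) (k n : nat) :
  [pchar F] =i pred0 -> (0 < n)%N ->
  codimension (@grassmannK F k) n (2 ^ n.-1 * (2 ^ k.+1 - 1))%N.
Proof.
move=> char0 n0; rewrite -card_index_good //.
set G := [set T | _].
pose idx (i : 'I_#|G|) : nf_index := index_nf (enum_val i).
have idx_inj : injective idx.
  by move=> i j /index_nf_inj/enum_val_inj.
have good (i : 'I_#|G|) : index_good (enum_val i : {set 'I_(k + n)}).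
  have gi : enum_val i \in G := enum_valP i; by rewrite /G in_set in gi.
have idx_valid i : nf_valid k (idx i) by apply: index_nf_valid.
have idx_homog i : homogeneous (iota 0 n)
    (normal_form (letter k) (idx i) : unitization (freeEX F)).
  apply: (homogeneous_perm _ (homogeneous_normal_form k (idx i))).
  rewrite letter_vars_degree //.
  have := perm_map (fun l => l - k)%N (index_nf_degree (enum_val i)).
  move=> /perm_trans; apply; rewrite (_ : map _ _ = iota 0 n) //.
  rewrite -[in iota k n](addn0 k) iotaDl -map_comp -[RHS]map_id.
  by apply: eq_map => l; rewrite /= addKn.
pose b i : freeEX F :=
  (normal_form (letter k) (idx i) : unitization (freeEX F)).2.
have bE i :
    normal_form (letter k) (idx i) = unit_inr (b i) :> unitization (freeEX F).
  have [nf1 _] := idx_homog i.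
  rewrite [LHS]surjective_pairing nf1 //.
  by case: (n) n0.
have comb_eval (c : 'I_#|G| -> F) a :
    eval (a : nat -> grassmannK k) (\sum_i c i *: b i) =
    unit_eval k a (linext (normal_form (letter k)) (\sum_i c i *: basis (idx i))).
  pose evL := GRing.isLinear.Build F _ _ *:%R _
    (eval_linear (a : nat -> grassmannK k)).
  pose ev : {linear _ -> _} := HB.pack (eval (a : nat -> grassmannK k)) evL.
  pose uevL := GRing.isLinear.Build F _ _ *:%R _ (@unit_eval_linear F k a).
  pose uev : {linear _ -> _} := HB.pack (unit_eval k a) uevL.
  rewrite -[LHS]/(ev _) -[RHS]/(uev _) !linear_sum; apply: eq_bigr => i _.
  by rewrite !linearZ /= linextU bE unit_eval_inr.
have coefE (c : 'I_#|G| -> F) j :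
    (\sum_i c i *: basis (idx i) : {malg F[nf_index]})@_(idx j) = c j.
  rewrite raddf_sum (bigD1 j) //= big1 => [|i ij].
    by rewrite mcoeffZ basisE mcoeffU eqxx mulr1 addr0.
  by rewrite mcoeffZ basisE mcoeffU (inj_eq idx_inj) (negbTE ij) mulr0.
exists b; split.
- by move=> i; have [_] := idx_homog i.
- move=> f fn.
  pose D p := nf_valid k p /\ perm_eq (nf_degree k p) (iota k n).
  have [|m mD fm] := free_normal_comb char0 (k := k) (D := D) (f := f).
    move=> u /fn un p vp up; split=> //; apply: perm_trans up _.
    exact: word_vars_shift.
  exists (fun i => m@_(idx i)) => a.
  rewrite evalB comb_eval.
  have -> : \sum_i m@_(idx i) *: basis (idx i) = m.
    apply/malgP => p; have [/mD[vp dp]|pm] := boolP (p \in msupp m).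
      have [T gT pT] := index_nf_surj vp dp.
      have TG : T \in G by rewrite /G inE.
      by rewrite pT -(enum_rankK_in TG TG) -/(idx _) coefE.
    rewrite (mcoeff_outdom pm) raddf_sum big1 //= => i _.
    rewrite mcoeffZ basisE mcoeffU; case: eqP => [->|_]; last by rewrite mulr0.
    by rewrite (mcoeff_outdom pm) mul0r.
  have := unit_eval_ideal a fm.
  have -> : unit_inr f - linext (normal_form (letter k)) m =
      (- 1) *: linext (normal_form (letter k)) m + unit_inr f.
    by rewrite scaleN1r addrC.
  by rewrite unit_eval_linear unit_eval_inr scaleN1r addrC.
move=> c c0 i; rewrite -(coefE c i).
rewrite (_ : \sum_i _ = 0) ?mcoeff0 //.
apply: (comb_independent char0 (k := k)) => [p|a]; last first.
  by rewrite -comb_eval; apply: c0.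
move=> pm; have [|/negP//] := boolP [exists i, p == idx i].
  by move=> /existsP[j /eqP->].
move=> nidx; move: pm; rewrite -mcoeff_neq0 raddf_sum big1 ?eqxx //= => j _.
rewrite mcoeffZ basisE mcoeffU; case: eqP => [jp|_]; last by rewrite mulr0.
by case: nidx; apply/existsP; exists j; rewrite jp.
Qed.

Theorem theorem8p3 (F : fieldType) (k : nat) :
  [pchar F] =i pred0 -> (1 <= k)%N ->
  (forall f : freeEX F,
     IdE (grassmannK k) f <->
     TW_span (fun g => grassmannK_gen k g \/ E_trivial g) f) /\
  (forall n : nat, (1 <= n)%N ->
     codimension (@grassmannK F k) n (2 ^ n.-1 * (2 ^ k.+1 - 1))%N).
Proof.
move=> char0 _; split=> [f|n n0]; first exact: IdE_generated.
exact: codimension_grassmannK.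
Qed.
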